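(* For every $n\ge 14$ and all sufficiently large $d$ (depending on $n$) there exists a generic real pencil of hypersurfaces of degree $d$ in $\mathbb{P}^n$ that contains at least $4d^n$ real hypersurfaces having a real singular point.
   Context: Hypersurfaces of degree $d$ in $\mathbb{P}^n$ are parametrized by $\mathbb{P}^N$, $N=\binom{n+d}{n}-1$, via the coefficients of the defining homogeneous polynomial. A real pencil is a line in $\mathbb{P}^N$ defined over $\mathbb{R}$ (for instance, the set of all degree $d$ hypersurfaces through $N-1$ real points of $\mathbb{P}^n$ in general position). A real singular hypersurface is one defined by a polynomial with real coefficients and possessing a singular point in $\mathbb{RP}^n$. ''Generic'' has the usual meaning for a line in $\mathbb{P}^N$ with respect to the discriminant hypersurface (the locus of singular hypersurfaces, which has degree $(n+1)(d-1)^n$): the pencil contains exactly $(n+1)(d-1)^n$ distinct complex singular hypersurfaces. *)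

(* Defs.v *)
From mathcomp Require Import all_boot all_order all_algebra.
From mathcomp Require Import reals.
From mathcomp Require Import complex mpoly.

Set Implicit Arguments.
Unset Strict Implicit.
Unset Printing Implicit Defensive.

Import GRing.Theory.
Local Open Scope ring_scope.

(* The points and the lines of the projective space P^N of hypersurfaces of
   degree d in P^n are the subspaces of dimension 1 and 2 of the vector space
   [dhomog n.+1 K d] of forms of degree d in n + 1 variables.  In particular a
   hypersurface is a subspace <[f]> with f != 0: a form up to a scalar. *)

Section SingularHypersurface.

Variables (K : fieldType) (n d : nat).

Definition singular_point (f : dhomog n.+1 K d) (x : 'rV[K]_n.+1) : Prop :=
  [/\ x != 0, f.@[x ord0] = 0 & forall i, f^`M(i).@[x ord0] = 0].

Definition singular_hypersurface (H : {vspace dhomog n.+1 K d}) : Prop :=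
  exists f : dhomog n.+1 K d,
    [/\ f != 0, H = <[f]>%VS & exists x : 'rV[K]_n.+1, singular_point f x].

End SingularHypersurface.

Section RealPencil.

Variables (R : realType) (n d : nat).

Lemma map_dhomog (f : dhomog n.+1 R d) :
  map_mpoly (real_complex R) f \is d.-homog.
Proof.
apply/dhomogP => m; rewrite mcoeff_msupp mcoeff_map_mpoly => fm.
have /dhomogP homf := dhomog_is_dhomog f; apply: homf.
by rewrite mcoeff_msupp; apply: contraNneq fm => /= ->.
Qed.

Definition complexify (f : dhomog n.+1 R d) : dhomog n.+1 R[i] d :=
  DHomog (map_dhomog f).

Definition complexify_space (W : {vspace dhomog n.+1 R d}) :
    {vspace dhomog n.+1 R[i] d} :=
  <<[seq complexify f | f <- vbasis W]>>%VS.

Definition real_pencil (L : {vspace dhomog n.+1 R[i] d}) : Prop :=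
  \dim L = 2 /\ exists W, L = complexify_space W.

Definition real_singular_hypersurface (H : {vspace dhomog n.+1 R[i] d}) :
    Prop :=
  exists f : dhomog n.+1 R d,
    [/\ f != 0, H = <[complexify f]>%VS
      & exists x : 'rV[R]_n.+1, singular_point f x].

(* (n + 1) (d - 1) ^ n is the degree of the discriminant hypersurface in P^N,
   so this says that L meets the discriminant in the maximal finite number of
   points. *)
Definition generic_pencil (L : {vspace dhomog n.+1 R[i] d}) : Prop :=
  exists s : seq {vspace dhomog n.+1 R[i] d},
    [/\ uniq s, size s = (n.+1 * d.-1 ^ n)%N
      & forall H, H \in s <-> (H <= L)%VS /\ singular_hypersurface H].

Definition contains_real_singular (k : nat)
    (L : {vspace dhomog n.+1 R[i] d}) : Prop :=
  exists s : seq {vspace dhomog n.+1 R[i] d},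
    [/\ uniq s, (k <= size s)%N
      & forall H, H \in s -> (H <= L)%VS /\ real_singular_hypersurface H].

End RealPencil.

(* Main.v *)
Require Import Defs.
From mathcomp Require Import all_boot all_order all_algebra.
From mathcomp Require Import reals.
From mathcomp Require Import complex mpoly.
From mathcomp Require Import boolp topology normedtype derive.
From mathcomp Require polyorder polyrcf.
From mathcomp Require Import ring lra.

(** The members of the pencil are F_t = sum_j q_j(z_j, x_0) + (C0 + C1 t) x_0^d,
   where the block q_j is a binary form of degree d depending linearly on t.  In
   the chart x_0 = 1 a singular point is a tuple of critical points s_j of the
   blocks whose critical values add up to zero with C0 + C1 t.

   Upper bound.  Write m = d - 1.  The critical values of the j-th block are the
   generalized eigenvalues of the Bezout pencil (V_j, U_j) of m x m matrices,
   where U_j is linear and V_j quadratic in t.  Hence the sums of critical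
   values are the eigenvalues of the corresponding Kronecker sum, a matrix of
   size m^n with entries of degree n + 1 in t, and its determinant has at most
   (n + 1) m^n roots.

   Lower bound.  Fix a monic S of degree d with m real positive critical points
   and distinct critical values, and let the j-th block be
   (t - tau_j) w_j S(z) + H (delta z)^d S(1 / (delta z)) for x_0 = 1.  As delta
   tends to 0,
   - for t away from the tau_j every block has m real critical points near those
     of S, and each of the m^n choices gives one real solution t;
   - for t - tau_i of order delta^d the m critical points of the i-th block are
     real and of order 1 / delta, and each of the m^n choices gives again one
     real solution t.
   This makes (n + 1) m^n distinct real values of t, so that every singular
   member of the pencil is real and n + 1 >= 8 is enough for 4 d^n of them. *)

Set Implicit Arguments.
Unset Strict Implicit.
Unset Printing Implicit Defensive.

Import Order.TTheory GRing.Theory Num.Theory.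
Import numFieldTopology.Exports numFieldNormedType.Exports.
Local Open Scope ring_scope.

(** * The determinantal upper bound *)

Section Bezout.

Variables (A : comNzRingType) (m : nat).
Implicit Types (f g q : {poly A}).

(* The derivative in x_0, at x_0 = 1, of q homogenized in degree m + 1. *)
Definition polar q : {poly A} := m.+1%:R *: q - 'X * q^`().

(** The coefficients of the Bezoutian of f and 1, that is of (f(x) - f(y)) / (x - y). *)
Definition bezU f (a b : 'I_m) : A := f`_(a + b).+1.

(** The coefficients of the Bezoutian of f and g; slicing both at degree a + 1 carries out the
    division by x - y. *)
Definition bezV f g (a b : 'I_m) : A :=
  (take_poly a.+1 g * drop_poly a.+1 f - take_poly a.+1 f * drop_poly a.+1 g)`_b.

Lemma size_polar q : (size q <= m.+2)%N -> (size (polar q) <= m.+1)%N.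
Proof.
move=> sq; apply/leq_sizeP => j; rewrite leq_eqVlt => /predU1P[<-|ltj].
  by rewrite /polar coefB coefZ coefXM /= coef_deriv mulr_natl subrr.
rewrite /polar coefB coefZ coefXM coef_deriv.
case: j ltj => [//|j] /= ltj.
by rewrite nth_default ?mulr0 ?mul0rn ?subrr // (leq_trans sq).
Qed.

Lemma polar_crit q x : q^`().[x] = 0 -> (polar q).[x] = m.+1%:R * q.[x].
Proof.
by move=> qx; rewrite /polar hornerD hornerN hornerZ hornerM qx mulr0 subr0.
Qed.

Lemma bezUE f x (a : 'I_m) : (size f <= m.+1)%N ->
  \sum_(b < m) bezU f a b * x ^+ b = (drop_poly a.+1 f).[x].
Proof.
move=> sf; rewrite (@horner_coef_wide _ m).
  by apply: eq_bigr => b _; rewrite coef_drop_poly /bezU addnS addnC.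
by rewrite size_drop_poly leq_subLR (leq_trans sf) // addSn ltnS leq_addl.
Qed.

(* The Bezoutian (f(x)g(y) - f(y)g(x)) / (x - y) is f(x)/(x - y) times g(y)
   when f(y) = 0. *)
Lemma bezVE f g x (a : 'I_m) : (size f <= m.+1)%N -> (size g <= m.+1)%N ->
  f.[x] = 0 ->
  \sum_(b < m) bezV f g a b * x ^+ b = g.[x] * (drop_poly a.+1 f).[x].
Proof.
move=> sf sg fx.
have sz (u v : {poly A}) : (size u <= m.+1)%N -> (size v <= m.+1)%N ->
    (size (take_poly a.+1 u * drop_poly a.+1 v)%R <= m)%N.
  move=> su sv; apply: leq_trans (size_polyMleq _ _) _.
  rewrite size_drop_poly -subn1 leq_subLR.
  apply: leq_trans (leq_add (size_take_poly _ _) (leq_sub2r _ sv)) _.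
  by rewrite subSS add1n addSn subnKC // ltnW.
rewrite -(@horner_coef_wide _ m); last first.
  by rewrite (leq_trans (size_polyD _ _)) // size_polyN geq_max !sz.
have eqf (u : {poly A}) : u.[x] = (take_poly a.+1 u).[x] + (drop_poly a.+1 u).[x] * x ^+ a.+1.
  by rewrite -{1}(poly_take_drop a.+1 u) hornerD hornerM hornerXn.
move: fx; rewrite hornerD hornerN !hornerM (eqf g) (eqf f) => /eqP.
by rewrite addr_eq0 => /eqP ->; ring.
Qed.

(** Horner's scheme: the values of [drop_poly a.+1 f] at y are the coefficients of the quotient of f
    - f(y) by X - y, and the sum telescopes. Over a field it vanishes at two distinct roots of f, so
    the power vectors of the roots are orthogonal for [bezU f]. *)
Lemma drop_poly_sum f x y : (size f <= m.+1)%N ->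
  (x - y) * (\sum_(a < m) x ^+ a * (drop_poly a.+1 f).[y]) = f.[x] - f.[y].
Proof.
move=> sf; rewrite mulrBl !mulr_sumr.
have step (a : 'I_m) : y * (x ^+ a * (drop_poly a.+1 f).[y]) =
    x ^+ a * (drop_poly a f).[y] - x ^+ a * f`_a.
  have -> : drop_poly a f = (f`_a)%:P + drop_poly a.+1 f * 'X.
    apply/polyP => -[|k]; rewrite coefD coefC coefMX !coef_drop_poly ?addr0 //=.
    by rewrite add0r addnS addSn.
  by rewrite hornerD hornerC hornerM hornerX; ring.
rewrite (eq_bigr _ (fun a _ => step a)) sumrB opprB addrCA.
rewrite [X in _ + (X - _)](eq_bigr (fun a : 'I_m =>
  x ^+ a.+1 * (drop_poly a.+1 f).[y])); last by move=> a _; rewrite mulrA -exprS.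
have e0 : drop_poly 0 f = f by apply/polyP => k; rewrite coef_drop_poly addn0.
have em : (drop_poly m f).[y] = f`_m.
  have -> : drop_poly m f = (f`_m)%:P.
    apply/polyP => -[|k]; rewrite coef_drop_poly coefC // nth_default //.
    by rewrite (leq_trans sf) // addSn ltnS leq_addl.
  by rewrite hornerC.
rewrite -(big_mkord xpredT (fun a => x ^+ a.+1 * (drop_poly a.+1 f).[y])).
rewrite -(big_mkord xpredT (fun a => x ^+ a * (drop_poly a f).[y])).
rewrite -sumrB telescope_sumr // em expr0 mul1r e0.
rewrite [in RHS](horner_coef_wide _ sf) big_ord_recr /= addrA; congr (_ - _).
by congr (_ + _); [apply: eq_bigr => i _; rewrite mulrC | rewrite mulrC].
Qed.

(** The value at x of the quotient of f - f(x) by X - x, found by differentiating the factorization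
    f = (X - x) Q + f(x). *)
Lemma drop_poly_sum_diag f x : (size f <= m.+1)%N ->
  \sum_(a < m) x ^+ a * (drop_poly a.+1 f).[x] = f^`().[x].
Proof.
move=> sf; pose Q : {poly A} := \poly_(a < m) (drop_poly a.+1 f).[x].
have -> : \sum_(a < m) x ^+ a * (drop_poly a.+1 f).[x] = Q.[x].
  by rewrite horner_poly; apply: eq_bigr => a _; rewrite mulrC.
have -> : f = ('X - x%:P) * Q + f.[x]%:P; last first.
  rewrite derivD derivC addr0 derivM derivB derivX derivC subr0 mul1r.
  by rewrite hornerD hornerM !hornerE subrr mul0r addr0.
suff E : ('X - x%:P) * Q = f - f.[x]%:P by rewrite E subrK.
apply/polyP => k; rewrite coefB coefC mulrBl coefB coefXM coefCM !coef_poly.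
have hd a : (drop_poly a f).[x] = f`_a + x * (drop_poly a.+1 f).[x].
  have -> : drop_poly a f = (f`_a)%:P + drop_poly a.+1 f * 'X.
    apply/polyP => -[|l]; rewrite coefD coefC coefMX !coef_drop_poly ?addr0 //=.
    by rewrite add0r addnS addSn.
  by rewrite hornerD hornerC hornerM hornerX mulrC.
have h0 a : (m <= a)%N -> (drop_poly a.+1 f).[x] = 0.
  move=> lea; suff -> : drop_poly a.+1 f = 0 by rewrite horner0.
  apply/polyP => l; rewrite coef_drop_poly coef0 nth_default //.
  by rewrite (leq_trans sf) // addnS ltnS (leq_trans lea) ?leq_addl.
have e0 : drop_poly 0 f = f by apply/polyP => l; rewrite coef_drop_poly addn0.
have hif a : (if (a < m)%N then (drop_poly a.+1 f).[x] else 0) =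
    (drop_poly a.+1 f).[x] by case: ltnP => // /h0 ->.
rewrite !hif; case: k => [|k] /=.
  by rewrite sub0r -{3}e0 (hd 0%N); ring.
by rewrite subr0 (hd k.+1); ring.
Qed.

End Bezout.

(** * Kronecker products and the matrix of a sum of blocks *)

Section Kronecker.

Variables (A : comNzRingType) (n m : nat).
Local Notation T := {ffun 'I_n -> 'I_m}.
Local Notation lbl x := (enum_val x : T).
Local Notation entry := ('I_n -> 'I_m -> 'I_m -> A).

Definition kron (F : entry) : 'M[A]_#|T| :=
  \matrix_(x, y) \prod_j F j (lbl x j) (lbl y j).

(** Mixed product rule: a product over j of sums over k expands into a sum over choice functions,
    which are exactly the inner indices. *)
Lemma kron_mul (F G : entry) :
  kron F *m kron G = kron (fun j a b => \sum_k F j a k * G j k b).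
Proof.
apply/matrixP => x y; rewrite !mxE bigA_distr_bigA /=.
rewrite (reindex (enum_val : 'I_#|T| -> T)) /=; last first.
  by apply: onW_bij; apply: enum_val_bij.
by apply: eq_bigr => z _; rewrite !mxE -big_split.
Qed.

Lemma kron_tr (F : entry) : (kron F)^T = kron (fun j a b => F j b a).
Proof. by apply/matrixP => x y; rewrite !mxE. Qed.

Lemma eq_kron (F G : entry) : (forall j a b, F j a b = G j a b) ->
  kron F = kron G.
Proof. by move=> FG; apply/matrixP => x y; rewrite !mxE; apply: eq_bigr. Qed.

(** With U_j and V_j the Bezout matrices of block j, this is the product of the U_j times the
    Kronecker sum of the U_j^-1 V_j plus the scalar (m + 1) C, multiplied out so that no U_j has to
    be inverted. The factor m + 1 matches the value of [polar] at a critical point. *)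
Definition starmx (q : 'I_n -> {poly A}) (C : A) : 'M[A]_#|T| :=
  m.+1%:R * C *: kron (fun j => bezU (q j)^`()) +
  \sum_i kron (fun j => if j == i then bezV (q j)^`() (polar m (q j))
                        else bezU (q j)^`()).

Lemma eq_starmx (q q' : 'I_n -> {poly A}) C :
  (forall j, q j = q' j) -> starmx q C = starmx q' C.
Proof.
move=> eq_q; congr (_ *: _ + _); first by apply: eq_kron => j a b; rewrite eq_q.
by apply: eq_bigr => i _; apply: eq_kron => j a b; rewrite eq_q.
Qed.

Lemma size_deriv_le (q : {poly A}) k : (size q <= k.+1)%N -> (size q^`() <= k)%N.
Proof.
move=> sq; apply/leq_sizeP => j lej; rewrite coef_deriv nth_default ?mul0rn //.
by rewrite (leq_trans sq).
Qed.

(** On the power vector of a critical point c_j, V_j acts as (m + 1) q_j(c_j) times U_j. Tensor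
    products of such vectors are therefore generalized eigenvectors, with the sums of critical
    values as eigenvalues up to the factor m + 1. *)
Lemma starmx_crit (q : 'I_n -> {poly A}) C (c : 'I_n -> 'I_m -> A) :
  (forall j, size (q j) <= m.+2)%N ->
  (forall j k, (q j)^`().[c j k] = 0) ->
  starmx q C *m kron (fun j a k => c j k ^+ a) =
  kron (fun j a k => (drop_poly a.+1 (q j)^`()).[c j k]) *m
  diag_mx (\row_z (m.+1%:R * (C + \sum_j (q j).[c j (lbl z j)]))).
Proof.
move=> sq cr; have sd j : (size (q j)^`() <= m.+1)%N by apply: size_deriv_le.
have E1 : kron (fun j => bezU (q j)^`()) *m kron (fun j a k => c j k ^+ a) =
    kron (fun j a k => (drop_poly a.+1 (q j)^`()).[c j k]).
  by rewrite kron_mul; apply: eq_kron => j a b; apply: bezUE.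
rewrite /starmx mulmxDl mulmx_suml -scalemxAl E1.
rewrite mul_mx_diag; apply/matrixP => x z.
rewrite 3!mxE summxE.
have E2 : forall i : 'I_n, (kron (fun j : 'I_n =>
     if j == i then bezV (q j)^`() (polar m (q j)) else bezU (q j)^`())
       *m kron (fun j a k => c j k ^+ a)) x z =
   (m.+1%:R * (q i).[c i (lbl z i)]) *
     \prod_j (drop_poly (lbl x j).+1 (q j)^`()).[c j (lbl z j)].
  move=> i; rewrite kron_mul mxE (bigD1 i) //= eqxx bezVE ?size_polar //.
  rewrite polar_crit // [in RHS](bigD1 i) //= !mulrA; congr (_ * _).
  by apply: eq_bigr => j /negPf ->; rewrite bezUE.
rewrite (eq_bigr _ (fun i _ => E2 i)) !mxE.
by rewrite -mulr_suml -mulrDl -mulr_sumr -mulrDr mulrC.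
Qed.

(** U_j and C have degree 1 and V_j has degree 2 in the data, so every summand has degree n + 1.
    This serves to exchange the ends t = 0 and t = infinity of a pencil. *)
Lemma starmxZ (q : 'I_n -> {poly A}) C a :
  starmx (fun j => a *: q j) (a * C) = a ^+ n.+1 *: starmx q C.
Proof.
have pZ j : polar m (a *: q j) = a *: polar m (q j).
  by rewrite /polar scalerBr derivZ scalerAr scalerA mulrC -scalerA.
have take_polyZ k (p : {poly A}) : take_poly k (a *: p) = a *: take_poly k p.
  by apply/polyP => l; rewrite !(coef_take_poly, coefZ); case: ifP; rewrite ?mulr0.
have drop_polyZ k (p : {poly A}) : drop_poly k (a *: p) = a *: drop_poly k p.
  by apply/polyP => l; rewrite !(coef_drop_poly, coefZ).
have UZ j x y : bezU (m := m) (a *: q j)^`() x y = a * bezU (q j)^`() x y.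
  by rewrite /bezU derivZ coefZ.
have VZ j x y : bezV (m := m) (a *: q j)^`() (polar m (a *: q j)) x y =
    a ^+ 2 * bezV (q j)^`() (polar m (q j)) x y.
  rewrite /bezV pZ derivZ !take_polyZ !drop_polyZ -!scalerAr -!scalerAl -scalerBr.
  by rewrite -scalerBr !coefZ mulrA -expr2.
rewrite /starmx scalerDr scalerA; congr (_ + _).
  apply/matrixP => x y; rewrite !mxE.
  under eq_bigr do rewrite UZ.
  by rewrite big_split prodr_const card_ord /= exprS; ring.
rewrite scaler_sumr; apply: eq_bigr => i _; apply/matrixP => x y; rewrite !mxE.
rewrite (bigD1 i) //= eqxx VZ [in RHS](bigD1 i) //= eqxx.
rewrite (eq_bigr (fun j => a * (if j == i then bezV (q j)^`() (polar m (q j))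
  else bezU (q j)^`()) (lbl x j) (lbl y j))); last first.
  by move=> j /negPf ->; rewrite UZ.
rewrite big_split prodr_const /= (cardC1 i) card_ord.
(* The index i rules out n = 0, for which 2 + (n - 1) would not be n + 1. *)
have -> : a ^+ n.+1 = a ^+ 2 * a ^+ n.-1.
  by rewrite -exprD; congr (_ ^+ _); case: n i => [[]|].
by rewrite mulrACA.
Qed.

End Kronecker.

Section MapStar.

Variables (A B : comNzRingType) (h : {rmorphism A -> B}) (n m : nat).

(** Lets the matrix be formed once over polynomials in t and then be evaluated at each t. *)
Lemma map_starmx (q : 'I_n -> {poly A}) C :
  map_mx h (starmx m q C) = starmx m (fun j => map_poly h (q j)) (h C).
Proof.
have tE k (p : {poly A}) : map_poly h (take_poly k p) = take_poly k (map_poly h p).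
  apply/polyP => l; rewrite coef_take_poly !coef_map coef_take_poly.
  by case: ifP => // _; apply: rmorph0.
have dE k (p : {poly A}) : map_poly h (drop_poly k p) = drop_poly k (map_poly h p).
  by apply/polyP => l; rewrite coef_drop_poly !coef_map coef_drop_poly.
have pE (p : {poly A}) : map_poly h (polar m p) = polar m (map_poly h p).
  by rewrite /polar rmorphB rmorphM /= map_polyX -deriv_map map_polyZ rmorph_nat.
have UE j x y : h (bezU (m := m) (q j)^`() x y) = bezU (map_poly h (q j))^`() x y.
  by rewrite /bezU deriv_map coef_map.
have VE j x y : h (bezV (m := m) (q j)^`() (polar m (q j)) x y) =
    bezV (map_poly h (q j))^`() (polar m (map_poly h (q j))) x y.
  by rewrite /bezV -coef_map rmorphB !rmorphM /= !tE !dE pE deriv_map.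
rewrite /starmx; apply/matrixP => x y; rewrite !mxE !summxE rmorphD !rmorphM /=.
rewrite rmorph_nat rmorph_prod rmorph_sum; congr (_ * _ + _).
  by apply: eq_bigr => j _; rewrite UE.
apply: eq_bigr => i _; rewrite !mxE rmorph_prod; apply: eq_bigr => j _.
by case: ifP => _; rewrite ?UE ?VE.
Qed.

End MapStar.

(** * Degree bounds for the determinant *)

Section DetSize.

Variables (K : fieldType).

Lemma size_prod_exp_le (I : finType) (F : I -> {poly K}) e :
  (forall i, size (F i) <= e.+1)%N -> (size (\prod_i F i)%R <= (e * #|I|).+1)%N.
Proof.
move=> sF; apply: leq_trans (size_prod_leq _ _) _.
rewrite leq_subLR addnS ltnS.
apply: leq_trans (leq_sum _ (fun i _ => sF i)) _.
by rewrite sum_nat_const mulnS mulnC.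
Qed.

Lemma size_det_le k (M : 'M[{poly K}]_k) e :
  (forall i j, size (M i j) <= e.+1)%N -> (size (\det M) <= (e * k).+1)%N.
Proof.
move=> sM; apply: leq_trans (size_sum _ _ _) _; apply/bigmax_leqP => s _.
rewrite size_Msign.
by apply: leq_trans (size_prod_exp_le _) _ => //; rewrite card_ord.
Qed.

End DetSize.

Section StarSize.

Variables (K : fieldType) (n m : nat).

Lemma size_mulX_le (p q : {poly K}) a b : (size p <= a.+1)%N ->
  (size q <= b.+1)%N -> (size (p * q)%R <= (a + b).+1)%N.
Proof.
move=> sp sq; apply: leq_trans (size_polyMleq _ _) _.
by rewrite -subn1 leq_subLR add1n -addnS -addSn leq_add.
Qed.

Lemma size_natr_mul (p : {poly K}) k : (size (k%:R * p)%R <= size p)%N.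
Proof. by rewrite mulr_natl -scaler_nat size_scale_leq. Qed.

(** Degree count in t: n linear factors and the linear C in the first summand, n - 1 linear factors
    and one quadratic V_i in each of the others. *)
Lemma size_starmx (q : 'I_n -> {poly {poly K}}) (C : {poly K}) x y :
  (forall j k, size ((q j)`_k)%R <= 2)%N -> (size C <= 2)%N ->
  (size (starmx m q C x y) <= n.+2)%N.
Proof.
move=> sq sC.
have sd j k : (size ((q j)^`()`_k)%R <= 2)%N.
  by rewrite coef_deriv -scaler_nat (leq_trans (size_scale_leq _ _)).
have sp j k : (size ((polar m (q j))`_k)%R <= 2)%N.
  rewrite /polar coefB coefZ coefXM coef_deriv (leq_trans (size_polyD _ _)) //.
  rewrite size_polyN geq_max (leq_trans (size_natr_mul _ _)) //=.
  case: eqP => _; first by rewrite size_poly0.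
  by rewrite -scaler_nat (leq_trans (size_scale_leq _ _)).
have sU j a b : (size (bezU (m := m) (q j)^`() a b) <= 2)%N by apply: sd.
have sM (u v : {poly {poly K}}) k : (forall k, size (u`_k)%R <= 2)%N ->
    (forall k, size (v`_k)%R <= 2)%N -> (size ((u * v)`_k)%R <= 3)%N.
  move=> su sv; rewrite coefM (leq_trans (size_sum _ _ _)) //.
  by apply/bigmax_leqP => i _; apply: (@size_mulX_le _ _ 1 1).
have sV j a b : (size (bezV (m := m) (q j)^`() (polar m (q j)) a b) <= 3)%N.
  rewrite /bezV coefB (leq_trans (size_polyD _ _)) //.
  rewrite size_polyN geq_max !sM // => k; rewrite ?coef_take_poly ?coef_drop_poly //;
    by case: ifP; rewrite ?size_poly0.
rewrite !mxE summxE (leq_trans (size_polyD _ _)) // geq_max; apply/andP; split.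
  rewrite -mulrA (leq_trans (size_natr_mul _ _)) // -[n.+1]add1n.
  apply: size_mulX_le => //; rewrite -[X in (_ <= X.+1)%N]mul1n.
  by rewrite -[X in (1 * X)%N]card_ord size_prod_exp_le.
apply: leq_trans (size_sum _ _ _) _; apply/bigmax_leqP => i _.
rewrite mxE (bigD1 i) //= eqxx.
have -> : n.+2 = (2 + n.-1).+1 by case: n i => [[]|].
apply: size_mulX_le => //.
apply: leq_trans (size_prod_leq _ _) _.
rewrite leq_subLR addnS ltnS (cardC1 i) card_ord.
apply: (@leq_trans (\sum_(j | j != i) 2)%N).
  by apply: leq_sum => j /negPf ->.
by rewrite sum_nat_const (cardC1 i) card_ord muln2 addnn.
Qed.

End StarSize.

(** * The discriminant polynomial of a pencil of sums of blocks *)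

Section StarDiscriminant.

Variables (K : numFieldType) (n m : nat).
Hypothesis m_gt0 : (0 < m)%N.
Local Notation T := {ffun 'I_n -> 'I_m}.

Definition star_critical (q : 'I_n -> {poly K}) (C : K) (s : 'I_n -> K) :=
  (forall j, (q j)^`().[s j] = 0) /\ C + \sum_j (q j).[s j] = 0.

(** A critical tuple with vanishing total value gives a kernel vector. All columns of [W] are the
    same tensor of power vectors, since the critical points are taken constant in k. *)
Lemma star_critical_det (q : 'I_n -> {poly K}) C s :
  (forall j, size (q j) <= m.+2)%N -> star_critical q C s ->
  \det (starmx m q C) = 0.
Proof.
move=> sq [cr sum0].
have := starmx_crit (c := fun j _ => s j) C sq (fun j _ => cr j).
rewrite sum0 mulr0.
set W := kron _; rewrite [X in _ = _ *m X](_ : _ = 0) ?mulmx0; last first.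
  by apply/matrixP => x y; rewrite !mxE mul0rn.
move=> MW0; apply/eqP; apply: contraT => detN0.
have unitM : starmx m q C \in unitmx by rewrite unitmxE unitfE.
have W0 : W = 0 by rewrite -(mulKmx unitM W) MW0 mulmx0.
(* At the zero multi-index all powers are s_j^0, so this entry of [W] is 1. *)
pose e : T := [ffun=> Ordinal m_gt0].
have := congr1 (fun M : 'M_ _ => M (enum_rank e) (enum_rank e)) W0.
rewrite !mxE enum_rankK big1 ?(rwP eqP) ?oner_eq0 // => j _.
by rewrite ffunE expr0.
Qed.

(** The tensor of Vandermonde matrices on the right and its transpose on the left diagonalize the
    matrix. The diagonal entries are products of second derivatives at the critical points with m +
    1 and a sum of critical values, all nonzero. *)
Lemma starmx_det_neq0 (q : 'I_n -> {poly K}) C (c : 'I_n -> 'I_m -> K) :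
  (forall j, size (q j) <= m.+2)%N ->
  (forall j, injective (c j)) ->
  (forall j k, (q j)^`().[c j k] = 0) ->
  (forall j k, (q j)^`()^`().[c j k] != 0) ->
  (forall s : T, C + \sum_j (q j).[c j (s j)] != 0) ->
  \det (starmx m q C) != 0.
Proof.
move=> sq cI cr crN sumN.
have /(congr1 (mulmx (kron (fun j a k => c j k ^+ a))^T)) := starmx_crit C sq cr.
rewrite kron_tr [X in _ = X]mulmxA kron_mul.
have -> : kron (fun j (a b : 'I_m) =>
      \sum_(k < m) c j a ^+ k * (drop_poly k.+1 (q j)^`()).[c j b]) =
    diag_mx (\row_z \prod_j (q j)^`()^`().[c j ((enum_val z : T) j)]).
  have sd j : (size (q j)^`() <= m.+1)%N by apply: size_deriv_le.
  apply/matrixP => x y; rewrite !mxE.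
  case: (eqVneq x y) => [<-|xy]; rewrite ?mulr1n ?mulr0n.
    by apply: eq_bigr => j _; rewrite drop_poly_sum_diag.
  have /forallPn[j xyj] : ~~ [forall j, (enum_val x : T) j == (enum_val y : T) j].
    apply: contra xy => /forallP h; apply/eqP/enum_val_inj/ffunP => j.
    by apply/eqP/h.
  rewrite (bigD1 j) //= [X in X * _](_ : _ = 0) ?mul0r //.
  apply/eqP;
  have := drop_poly_sum (c j ((enum_val x : T) j)) (c j ((enum_val y : T) j)) (sd j).
  rewrite !cr subrr => /eqP; rewrite mulf_eq0 subr_eq0 (inj_eq (cI j)).
  by rewrite (negPf xyj).
move=> /(congr1 determinant); rewrite !det_mulmx => eqdet.
have: \det (kron (fun j (a b : 'I_m) => c j a ^+ b)) *
   (\det (starmx m q C) * \det (kron (fun j (a k : 'I_m) => c j k ^+ a))) != 0.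
  rewrite eqdet !det_diag mulf_neq0 //; apply/prodf_neq0 => z _; rewrite mxE.
    by apply/prodf_neq0 => j _.
  by rewrite mulf_neq0 // pnatr_eq0.
by rewrite !mulf_eq0 !negb_or => /and3P[].
Qed.

Lemma poly_nonroot (p : {poly K}) (B : nat) : p != 0 ->
  exists2 k : nat, (B <= k)%N & p.[k%:R] != 0.
Proof.
move=> pN0; pose rs : seq K := [seq k%:R | k <- iota B (size p)].
have uniq_rs : uniq rs.
  rewrite map_inj_uniq ?iota_uniq // => k l /eqP.
  by rewrite eqr_nat => /eqP.
have /allPn[x /mapP[k]] : ~~ all (root p) rs.
  apply/negP => /(max_poly_roots pN0)/(_ uniq_rs).
  by rewrite size_map size_iota ltnn.
by rewrite mem_iota => /andP[Bk _] -> rk; exists k.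
Qed.

(** D is the determinant as a polynomial in t. Its coefficient of degree (n + 1) m^n belongs to the
    member at t = infinity; that D is nonzero is read off from the reversed pencil q1 + t q0. *)
Lemma star_discriminant (q0 q1 : 'I_n -> {poly K}) (C0 C1 : K) :
  (forall j, size (q0 j) <= m.+2)%N -> (forall j, size (q1 j) <= m.+2)%N ->
  \det (starmx m q1 C1) != 0 ->
  exists D : {poly K}, [/\ D != 0, (size D <= (n.+1 * m ^ n).+1)%N
    & forall t s, star_critical (fun j => q0 j + t *: q1 j) (C0 + t * C1) s ->
        root D t].
Proof.
move=> sq0 sq1 det1.
pose Q (a b : 'I_n -> {poly K}) j : {poly {poly K}} :=
  map_poly polyC (a j) + 'X *: map_poly polyC (b j).
pose D a A b B := \det (starmx m (Q a b) (A%:P + 'X * B%:P)).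
have evD a A b B t : (D a A b B).[t] =
    \det (starmx m (fun j => a j + t *: b j) (A + t * B)).
  rewrite -horner_evalE -det_map_mx map_starmx /= horner_evalE hornerD hornerC.
  rewrite hornerM hornerX hornerC; congr (\det _); apply: eq_starmx => j.
  apply/polyP => k; rewrite coef_map coefD coefZ !coef_map /= horner_evalE.
  by rewrite hornerD hornerC hornerM hornerX hornerC coefD coefZ.
have D1N0 : D q1 C1 q0 C0 != 0.
  apply: contra_neq det1 => D0; have := evD q1 C1 q0 C0 0.
  rewrite D0 horner0 mul0r addr0 => ->; congr (\det _); apply: eq_starmx => j.
  by rewrite scale0r addr0.
(* The reversed determinant is nonzero at 0, hence at some positive integer k; by homogeneity D is
   then nonzero at 1 / k. *)
have [k k_gt0 DkN0] := poly_nonroot 1 D1N0.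
have kN0 : k%:R != 0 :> K by rewrite pnatr_eq0 -lt0n.
exists (D q0 C0 q1 C1); split.
- apply: contra_neq DkN0 => D0; rewrite evD.
  have := evD q0 C0 q1 C1 k%:R^-1; rewrite D0 horner0.
  have -> : C0 + k%:R^-1 * C1 = k%:R^-1 * (C1 + k%:R * C0).
    by rewrite mulrDr mulKf // addrC.
  rewrite (@eq_starmx _ _ _ _ (fun j => k%:R^-1 *: (q1 j + k%:R *: q0 j))).
    move=> /esym; rewrite starmxZ detZ => /eqP.
    by rewrite mulf_eq0 expf_eq0 expf_eq0 invr_eq0 (negPf kN0) !andbF => /eqP.
  by move=> j; rewrite scalerDr scalerA mulVf // scale1r addrC.
- have sz (a b : K) : (size (a%:P + 'X * b%:P)%R <= 2)%N.
    rewrite (leq_trans (size_polyD _ _)) // geq_max.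
    rewrite (leq_trans (size_polyC_leq1 _)) //=.
    by rewrite (@size_mulX_le _ _ _ 1 0) ?size_polyX ?size_polyC_leq1.
  have -> : (n.+1 * m ^ n = n.+1 * #|T|)%N by rewrite card_ffun !card_ord.
  apply: size_det_le => x y; apply: size_starmx => // j k'.
  by rewrite coefD coefZ !coef_map /= sz.
- move=> t s crit; rewrite /root evD; apply/eqP/(star_critical_det _ crit) => j.
  rewrite (leq_trans (size_polyD _ _)) // geq_max sq0 /=.
  by rewrite (leq_trans (size_scale_leq _ _)).
Qed.

End StarDiscriminant.

(** * Star-shaped forms and their pencils *)

Section StarForm.

Variables (K : fieldType) (n d : nat).
Implicit Types (q : 'I_n -> {poly K}) (C : K).

Definition star_mpoly q C : {mpoly K[n.+1]} :=
  \sum_j \sum_(k < d.+1) (q j)`_k *: ('X_(lift ord0 j) ^+ k * 'X_ord0 ^+ (d - k))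
  + C *: 'X_ord0 ^+ d.

Lemma star_mpoly_homog q C : star_mpoly q C \is d.-homog.
Proof.
have hX (i : 'I_n.+1) k : ('X_i : {mpoly K[n.+1]}) ^+ k \is k.-homog.
  rewrite -[X in X.-homog]mul1n; apply: dhomogMn.
  by rewrite dhomogX; apply/eqP/mdeg1.
apply: rpredD; last by apply: rpredZ.
apply: rpred_sum => j _; apply: rpred_sum => k _; apply: rpredZ.
by have := dhomogM (hX (lift ord0 j) k) (hX ord0 (d - k)%N); rewrite subnKC // -ltnS.
Qed.

Definition star q C : dhomog n.+1 K d := DHomog (star_mpoly_homog q C).

Lemma starD q C q' C' t :
  star (fun j => q j + t *: q' j) (C + t * C') = star q C + t *: star q' C'.
Proof.
apply: val_inj; transitivity (star_mpoly q C + t *: star_mpoly q' C') => //=.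
rewrite /star_mpoly scalerDr addrACA.
rewrite scalerA -scalerDl; congr (_ + _); rewrite scaler_sumr -big_split /=.
apply: eq_bigr => j _; rewrite scaler_sumr -big_split /=.
by apply: eq_bigr => k _; rewrite coefD coefZ scalerDl scalerA.
Qed.

Lemma mderiv_sum (I : finType) (F : I -> {mpoly K[n.+1]}) i :
  (\sum_k F k)^`M(i) = \sum_k (F k)^`M(i).
Proof. exact: (raddf_sum (mderiv i)). Qed.

Lemma meval_sum (I : finType) (F : I -> {mpoly K[n.+1]}) v :
  (\sum_k F k).@[v] = \sum_k (F k).@[v].
Proof. exact: (raddf_sum (meval v)). Qed.

Lemma mderivXn (p : {mpoly K[n.+1]}) k i :
  (p ^+ k)^`M(i) = k%:R *: (p ^+ k.-1 * p^`M(i)).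
Proof.
elim: k => [|k IHk]; first by rewrite expr0 -mpolyC1 mderivC scale0r.
rewrite exprS mderivM IHk -scalerAr mulrA.
have -> : k%:R *: (p * p ^+ k.-1 * p^`M(i)) = k%:R *: (p ^+ k * p^`M(i)).
  by case: k {IHk} => [|k]; rewrite ?scale0r // -exprS.
by rewrite [p^`M(i) * _]mulrC -[X in X + _]scale1r -scalerDl -mulrS.
Qed.

Lemma meval_star q C v : (star q C).@[v] =
  \sum_j \sum_(k < d.+1) (q j)`_k * (v (lift ord0 j) ^+ k * v ord0 ^+ (d - k))
  + C * v ord0 ^+ d.
Proof.
rewrite /= mevalD mevalZ rmorphXn /= mevalXU; congr (_ + _).
rewrite rmorph_sum; apply: eq_bigr => j _; rewrite rmorph_sum /=.
by apply: eq_bigr => k _; rewrite mevalZ mevalM !rmorphXn /= !mevalXU.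
Qed.

Lemma mderivXU i j : ('X_i : {mpoly K[n.+1]})^`M(j) = (i == j)%:R.
Proof.
rewrite mderivX mnm1E; case: eqP => [->|_]; last by rewrite scale0r.
by rewrite -[X in (X - _)%MM]add0m addmK mpolyX0 scale1r.
Qed.

Lemma meval_star_deriv_lift q C v i : (star q C)^`M(lift ord0 i).@[v] =
  \sum_(k < d.+1) (q i)`_k * (k%:R * v (lift ord0 i) ^+ k.-1 * v ord0 ^+ (d - k)).
Proof.
rewrite /= mderivD mderivZ mderivXn mderivXU -(negbK (ord0 == _)) neq_lift /=.
rewrite mulr0 !scaler0 addr0 mderiv_sum meval_sum (bigD1 i) //= [X in _ + X]big1 ?addr0.
  rewrite mderiv_sum meval_sum /=; apply: eq_bigr => k _.
  rewrite mderivZ mevalZ mderivM !mderivXn !mderivXU eqxx.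
  rewrite -(negbK (ord0 == _)) neq_lift /= !mulr0 !scaler0 mulr0 addr0 mulr1.
  by rewrite mevalM mevalZ !rmorphXn /= !mevalXU.
move=> j ji; rewrite mderiv_sum meval_sum /= big1 // => k _.
rewrite mderivZ mevalZ mderivM !mderivXn !mderivXU.
rewrite (inj_eq (@lift_inj _ _)) (negPf ji) -(negbK (ord0 == _)) neq_lift /=.
by rewrite !mulr0 !scaler0 mul0r mulr0 addr0 meval0 mulr0.
Qed.

Lemma meval_star_deriv0 q C v : (star q C)^`M(ord0).@[v] =
  \sum_j \sum_(k < d.+1) (q j)`_k *
     (v (lift ord0 j) ^+ k * ((d - k)%:R * v ord0 ^+ (d - k).-1))
  + C * (d%:R * v ord0 ^+ d.-1).
Proof.
rewrite /= mderivD mderivZ mderivXn mderivXU eqxx mulr1 mevalD !mevalZ.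
rewrite rmorphXn /= mevalXU; congr (_ + _); rewrite mderiv_sum meval_sum /=.
apply: eq_bigr => j _; rewrite mderiv_sum meval_sum /=; apply: eq_bigr => k _.
rewrite mderivZ mevalZ mderivM !mderivXn !mderivXU eqxx.
rewrite eq_sym -(negbK (ord0 == _)) neq_lift /= !mulr0 !scaler0 mul0r add0r mulr1.
by rewrite mevalM mevalZ !rmorphXn /= !mevalXU.
Qed.

End StarForm.

(** * Singular points in the chart and at infinity *)

Section StarSingular.

Variables (K : numFieldType) (n m : nat).
Implicit Types (q : 'I_n -> {poly K}) (C : K).
Local Notation star := (@star K n m.+1).

Lemma star_critical_singular q C s : (0 < m)%N ->
  (forall j, size (q j) <= m.+2)%N -> star_critical q C s ->
  singular_point (star q C) (\row_i (if unlift ord0 i is Some j then s j else 1)).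
Proof.
move=> m_gt0 sq [cr sum0]; set x := \row_i _.
have x0 : x ord0 ord0 = 1 by rewrite mxE unlift_none.
have xl j : x ord0 (lift ord0 j) = s j by rewrite mxE liftK.
have ev0 : (star q C).@[x ord0] = 0.
  rewrite meval_star x0 expr1n mulr1 addrC -[RHS]sum0; congr (_ + _).
  apply: eq_bigr => j _; rewrite (horner_coef_wide _ (sq j)) xl.
  by apply: eq_bigr => k _; rewrite expr1n mulr1.
split => //.
  apply/eqP => /rowP/(_ ord0) /eqP; rewrite x0 mxE oner_eq0 //.
move=> i; case: (unliftP ord0 i) => [j|] ->.
  rewrite meval_star_deriv_lift x0 xl -[RHS](cr j).
  rewrite (horner_coef_wide _ (size_deriv_le (sq j))) big_ord_recl mul0r mul0r mulr0 add0r.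
  apply: eq_bigr => k _; rewrite expr1n mulr1 coef_deriv /= /bump /= add1n add0n.
  by rewrite -mulr_natl; ring.
rewrite meval_star_deriv0 x0 expr1n mulr1.
(* Euler's identity at a zero of all the other partial derivatives. *)
have eul j : \sum_(k < m.+2) (q j)`_k * (x ord0 (lift ord0 j) ^+ k *
    ((m.+1 - k)%:R * 1 ^+ (m.+1 - k).-1)) = m.+1%:R * (q j).[s j].
  rewrite -(polar_crit _ (cr j)) (horner_coef_wide _ (size_polar (sq j))) xl.
  rewrite big_ord_recr /= subnn mul0r !mulr0 addr0; apply: eq_bigr => k _.
  rewrite expr1n mulr1 /polar coefB coefZ coefXM.
  have -> : (if (k : nat) == 0%N then 0 else (q j)^`()`_k.-1) = k%:R * (q j)`_k.
    by case: (k : nat) => [|l]; rewrite ?mul0r // coef_deriv mulr_natl.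
  by rewrite natrB ?(ltnW (ltn_ord k)) //; ring.
rewrite (eq_bigr _ (fun j _ => eul j)) -mulr_sumr [C * _]mulrC -mulrDr.
by rewrite addrC sum0 mulr0.
Qed.

Lemma singular_star_critical q C (x : 'rV[K]_n.+1) :
  (forall j, size (q j) <= m.+2)%N ->
  singular_point (star q C) x -> x ord0 ord0 != 0 ->
  star_critical q C (fun j => x ord0 (lift ord0 j) / x ord0 ord0).
Proof.
move=> sq [_ f0 df0] x0; split=> [j|].
  have := df0 (lift ord0 j); rewrite meval_star_deriv_lift => eq0.
  apply: (mulfI (expf_neq0 m x0)); rewrite mulr0 -[RHS]eq0.
  rewrite (horner_coef_wide _ (size_deriv_le (sq j))) mulr_sumr.
  rewrite [RHS]big_ord_recl mul0r mul0r mulr0 add0r.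
  apply: eq_bigr => k _; rewrite coef_deriv /= /bump /= add1n add0n subSS.
  rewrite -mulr_natl expr_div_n -{1}(subnK (ltnSE (ltn_ord k))) exprD.
  have xk := expf_neq0 k x0.
  by field.
apply: (mulfI (expf_neq0 m.+1 x0)); rewrite mulr0 -[RHS]f0 meval_star.
rewrite mulrDr addrC [_ * C]mulrC; congr (_ + _); rewrite mulr_sumr.
apply: eq_bigr => j _; rewrite (horner_coef_wide _ (sq j)) mulr_sumr.
apply: eq_bigr => k _.
rewrite expr_div_n -{1}(subnK (ltnSE (ltn_ord k))) exprD.
have xk := expf_neq0 k x0.
by field.
Qed.

(** On x_0 = 0 the derivative in z_j sees only the top coefficient of q_j, and the derivative in x_0
    only the coefficients just below the top; as m > 0, the term of C disappears. *)
Lemma singular_star_infinity q C (x : 'rV[K]_n.+1) : (0 < m)%N ->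
  singular_point (star q C) x -> x ord0 ord0 = 0 ->
  (forall j, (q j)`_m.+1 * x ord0 (lift ord0 j) = 0) /\
  \sum_j (q j)`_m * x ord0 (lift ord0 j) ^+ m = 0.
Proof.
move=> m_gt0 [_ _ df0] x0; split=> [j|].
  have := df0 (lift ord0 j); rewrite meval_star_deriv_lift x0.
  rewrite big_ord_recr big1 /= ?add0r => [|k _]; last first.
    by rewrite expr0n subn_eq0 leqNgt ltn_ord !mulr0.
  rewrite subnn mulr1 => /eqP; rewrite !mulf_eq0 pnatr_eq0 expf_eq0 m_gt0 /=.
  by case/orP => /eqP ->; rewrite ?mul0r ?mulr0.
have := df0 ord0; rewrite meval_star_deriv0 x0 expr0n -(negbK (m == 0%N)) -lt0n m_gt0.
rewrite !mulr0 addr0 => eq0; rewrite -[RHS]eq0; apply: eq_bigr => j _.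
rewrite 2!big_ord_recr big1 /= ?add0r => [|k _]; last first.
  rewrite expr0n subSn ?(ltnW (ltn_ord k)) //= subn_eq0 leqNgt ltn_ord.
  by rewrite !mulr0.
by rewrite subnn mul0r !mulr0 addr0 subSnn !mulr1.
Qed.

End StarSingular.

(** * From enough real critical parameters to a generic real pencil *)

Section Pencil.

Variables (R : realType) (n m : nat).
Hypotheses (m_gt0 : (0 < m)%N) (n_gt1 : (1 < n)%N).
Local Notation rc := (real_complex R).
Local Notation T := {ffun 'I_n -> 'I_m}.

Lemma complexify_is_linear (a b : R) (u v : dhomog n.+1 R m.+1) :
  complexify (a *: u + b *: v) = rc a *: complexify u + rc b *: complexify v.
Proof.
apply: val_inj.
transitivity (rc a *: map_mpoly rc u + rc b *: map_mpoly rc v) => //=.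
by rewrite raddfD /= !map_mpolyZ.
Qed.

Lemma complexify_sum (I : finType) (a : I -> R) (u : I -> dhomog n.+1 R m.+1) :
  complexify (\sum_i a i *: u i) = \sum_i rc (a i) *: complexify (u i).
Proof.
have c0 : complexify (0 : dhomog n.+1 R m.+1) = 0.
  by have := complexify_is_linear 0 0 0 0; rewrite !scale0r !addr0.
have cD (x y : dhomog n.+1 R m.+1) : complexify (x + y) = complexify x + complexify y.
  by have := complexify_is_linear 1 1 x y; rewrite rmorph1 !scale1r.
have cZ c (x : dhomog n.+1 R m.+1) : complexify (c *: x) = rc c *: complexify x.
  by have := complexify_is_linear c 0 x 0; rewrite c0 scale0r scaler0 !addr0.
apply: (big_rec2 (fun x y => complexify x = y)) => // i x y _ <-.
by rewrite cD cZ.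
Qed.

Lemma complexify_star (q : 'I_n -> {poly R}) C :
  complexify (star m.+1 q C) = star m.+1 (fun j => map_poly rc (q j)) (rc C).
Proof.
apply: val_inj; rewrite /= /star_mpoly (raddfD (map_mpoly rc)) /= map_mpolyZ rmorphXn /=.
rewrite map_mpolyX.
congr (_ + _); rewrite (rmorph_sum (map_mpoly rc)); apply: eq_bigr => j _.
rewrite (rmorph_sum (map_mpoly rc)); apply: eq_bigr => k _.
rewrite coef_map /=; etransitivity; first exact: map_mpolyZ.
by rewrite rmorphM !rmorphXn /= !map_mpolyX.
Qed.

Lemma span2P (K : fieldType) (V : vectType K) (u v w : V) :
  reflect (exists a b, w = a *: u + b *: v) (w \in <<[:: u; v]>>%VS).
Proof.
rewrite span_cons span_seq1; apply: (iffP memv_addP) => [[x /vlineP[a ->]]|].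
  by case=> y /vlineP[b ->] ->; exists a, b.
case=> a [b ->]; exists (a *: u); first by rewrite memvZ // memv_line.
by exists (b *: v) => //; rewrite memvZ // memv_line.
Qed.

(** [complexify_space] goes through the chosen basis [vbasis]; by linearity any spanning pair can
    replace it. *)
Lemma complexify_span2 (u v : dhomog n.+1 R m.+1) :
  complexify_space <<[:: u; v]>> = <<[:: complexify u; complexify v]>>%VS.
Proof.
set W := <<[:: u; v]>>%VS; apply/eqP; rewrite eqEsubv; apply/andP; split.
  apply/span_subvP => _ /mapP[w /vbasis_mem /span2P[a [b ->]] ->].
  by apply/span2P; exists (rc a), (rc b); rewrite complexify_is_linear.
have sub w : w \in W -> complexify w \in complexify_space W.
  move=> /coord_vbasis ->; rewrite complexify_sum; apply: memv_suml => i _.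
  apply/memvZ/memv_span/map_f/mem_nth.
  by rewrite size_tuple.
apply/span_subvP => w; rewrite !inE => /orP[] /eqP ->; apply: sub; apply/span2P.
  by exists 1, 0; rewrite scale1r scale0r addr0.
by exists 0, 1; rewrite scale1r scale0r add0r.
Qed.

Lemma singular_pointZ (K : fieldType) d (a : K) (f : dhomog n.+1 K d) x :
  a != 0 -> singular_point (a *: f) x -> singular_point f x.
Proof.
move=> aN0 [xN0 fx dfx]; split=> // [|i]; apply: (mulfI aN0).
  by rewrite mulr0 -[RHS]fx -mevalZ.
by rewrite mulr0 -[RHS](dfx i) -mevalZ -mderivZ.
Qed.

Lemma meval_star_unit (K : fieldType) (q : 'I_n -> {poly K}) C i :
  (star m.+1 q C).@[fun k => (k == lift ord0 i)%:R] = (q i)`_m.+1.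
Proof.
rewrite meval_star (negPf (neq_lift _ _)) expr0n /= mulr0 addr0.
rewrite (bigD1 i) //= [X in _ + X]big1 ?addr0 => [|j ji].
  rewrite big_ord_recr big1 /= ?add0r => [|k _]; last first.
    by rewrite expr0n subn_eq0 leqNgt ltn_ord !mulr0.
  by rewrite eqxx subnn expr1n !mulr1.
rewrite big1 // => k _; rewrite (inj_eq (@lift_inj _ _)) (negPf ji) expr0n expr0n.
rewrite subn_eq0; case: (eqVneq (k : nat) 0%N) => [->|_]; last by rewrite mul0r mulr0.
by rewrite ltn0 !mulr0.
Qed.

Lemma meval_lincomb (K : fieldType) d (a b : K) (u v : dhomog n.+1 K d) x :
  (a *: u + b *: v).@[x] = a * u.@[x] + b * v.@[x].
Proof.
transitivity (meval x (a *: mpoly_of_dhomog u + b *: mpoly_of_dhomog v)) => //.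
by rewrite mevalD !mevalZ.
Qed.

(** The hypotheses on q1 make the member at t = infinity smooth and the discriminant nonzero;
    [inf_ne] and [inf_simple] exclude singular points on x_0 = 0. The discriminant has degree at
    most (n + 1) m^n, so the real parameters [ts] exhaust its complex roots. *)
Lemma star_pencil (q0 q1 : 'I_n -> {poly R}) (C0 C1 : R)
    (c : 'I_n -> 'I_m -> R) (ts : seq R) :
  (forall j, size (q0 j) <= m.+2)%N -> (forall j, size (q1 j) <= m.+2)%N ->
  (forall j, (q1 j)`_m.+1 != 0) ->
  (forall j, injective (c j)) ->
  (forall j k, (q1 j)^`().[c j k] = 0) ->
  (forall j k, (q1 j)^`()^`().[c j k] != 0) ->
  (forall s : T, C1 + \sum_j (q1 j).[c j (s j)] != 0) ->
  (forall i j, i != j ->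
     (q0 i)`_m.+1 * (q1 j)`_m.+1 != (q0 j)`_m.+1 * (q1 i)`_m.+1) ->
  (forall j, (q0 j)`_m.+1 * (q1 j)`_m != (q0 j)`_m * (q1 j)`_m.+1) ->
  uniq ts -> size ts = (n.+1 * m ^ n)%N ->
  (forall t, t \in ts ->
     exists s, star_critical (fun j => q0 j + t *: q1 j) (C0 + t * C1) s) ->
  exists L : {vspace dhomog n.+1 R[i] m.+1},
    [/\ real_pencil L, generic_pencil L
      & contains_real_singular (n.+1 * m ^ n)%N L].
Proof.
move=> sq0 sq1 lead1 cI cr crN sumN inf_ne inf_simple uniq_ts size_ts ts_crit.
pose Q0 j := map_poly rc (q0 j); pose Q1 j := map_poly rc (q1 j).
have sQ0 j : (size (Q0 j) <= m.+2)%N by rewrite size_map_poly.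
have sQ1 j : (size (Q1 j) <= m.+2)%N by rewrite size_map_poly.
pose F := star m.+1 q0 C0; pose G := star m.+1 q1 C1.
pose f := complexify F; pose g := complexify G.
have fE : f = star m.+1 Q0 (rc C0) by apply: complexify_star.
have gE : g = star m.+1 Q1 (rc C1) by apply: complexify_star.
have fgE t : f + t *: g = star m.+1 (fun j => Q0 j + t *: Q1 j) (rc C0 + t * rc C1).
  by rewrite fE gE starD.
have FGE t : F + t *: G = star m.+1 (fun j => q0 j + t *: q1 j) (C0 + t * C1).
  by rewrite starD.
have cFG t : complexify (F + t *: G) = f + rc t *: g.
  by have := complexify_is_linear 1 t F G; rewrite rmorph1 !scale1r.
(* At a coordinate point of an axis z_i the two forms take the values of their top coefficients, and
   [inf_ne] makes the 2 x 2 system from two axes invertible. *)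
have indep a b : a *: f + b *: g = 0 -> a = 0 /\ b = 0.
  move=> ab0.
  have ev i : a * rc (q0 i)`_m.+1 + b * rc (q1 i)`_m.+1 = 0.
    pose e k : R[i] := (k == lift ord0 i)%:R.
    have ev0 : f.@[e] = rc (q0 i)`_m.+1 by rewrite fE meval_star_unit coef_map.
    have ev1 : g.@[e] = rc (q1 i)`_m.+1 by rewrite gE meval_star_unit coef_map.
    rewrite -ev0 -ev1 -meval_lincomb ab0; exact: meval0.
  pose i0 : 'I_n := Ordinal (ltnW n_gt1); pose i1 : 'I_n := Ordinal n_gt1.
  have det_ne : rc ((q0 i0)`_m.+1 * (q1 i1)`_m.+1 - (q0 i1)`_m.+1 * (q1 i0)`_m.+1) != 0.
    by rewrite fmorph_eq0 subr_eq0 inf_ne.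
  have aD : a * rc ((q0 i0)`_m.+1 * (q1 i1)`_m.+1 - (q0 i1)`_m.+1 * (q1 i0)`_m.+1) = 0.
    rewrite rmorphB !rmorphM /=.
    transitivity ((a * rc (q0 i0)`_m.+1 + b * rc (q1 i0)`_m.+1) * rc (q1 i1)`_m.+1
       - (a * rc (q0 i1)`_m.+1 + b * rc (q1 i1)`_m.+1) * rc (q1 i0)`_m.+1).
      by ring.
    by rewrite !ev !mul0r subrr.
  have a0 : a = 0 by move/eqP: aD; rewrite mulf_eq0 (negPf det_ne) orbF => /eqP.
  split=> //; have /eqP := ev i0; rewrite a0 mul0r add0r mulf_eq0 fmorph_eq0.
  by rewrite (negPf (lead1 _)) orbF => /eqP.
have det_g : \det (starmx m Q1 (rc C1)) != 0.
  apply: (@starmx_det_neq0 _ n m Q1 (rc C1) (fun j k => rc (c j k)) sQ1).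
  - by move=> j k l /fmorph_inj /cI.
  - by move=> j k; rewrite deriv_map horner_map cr rmorph0.
  - by move=> j k; rewrite !deriv_map horner_map fmorph_eq0.
  - move=> s; rewrite (eq_bigr (fun j => rc (q1 j).[c j (s j)])) => [|j _].
      by rewrite -rmorph_sum -rmorphD fmorph_eq0.
    by rewrite horner_map.
have g_smooth x : ~ singular_point g x.
  rewrite gE => sing.
  have [x0|x0] := eqVneq (x ord0 ord0) 0; last first.
    move: det_g; rewrite (star_critical_det m_gt0 sQ1 (singular_star_critical sQ1 sing x0)).
    by rewrite eqxx.
  have [zl _] := singular_star_infinity m_gt0 sing x0.
  case: sing => /eqP[]; apply/rowP => i; rewrite mxE.
  have [j|] := unliftP ord0 i; move=> -> //; have /eqP := zl j.
  by rewrite coef_map mulf_eq0 fmorph_eq0 (negPf (lead1 _)) => /eqP.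
(* A nonzero coordinate i at infinity forces the top coefficient of block i to vanish at t. By
   [inf_ne] there is only one such i, and then the coefficient below would vanish too, against
   [inf_simple]. *)
have no_inf t x : singular_point (f + t *: g) x -> x ord0 ord0 != 0.
  rewrite fgE => sing; apply: contraT; rewrite negbK => /eqP x0.
  have [zl zs] := singular_star_infinity m_gt0 sing x0.
  have [i xi] : exists i, x ord0 (lift ord0 i) != 0.
    apply/existsP; rewrite -negb_forall; apply/negP => /forallP x_eq0.
    case: sing => /eqP[]; apply/rowP => i; rewrite mxE.
    by have [j|] := unliftP ord0 i; move=> -> //; apply/eqP.
  have ai j : x ord0 (lift ord0 j) != 0 ->
      rc (q0 j)`_m.+1 = - t * rc (q1 j)`_m.+1.
    move=> xj; have /eqP := zl j; rewrite mulf_eq0 (negPf xj) orbF.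
    by rewrite coefD coefZ !coef_map addr_eq0 -mulNr => /eqP.
  have xj0 j : j != i -> x ord0 (lift ord0 j) = 0.
    move=> ji; apply/eqP; apply: contraT => xj.
    have := inf_ne _ _ ji; rewrite -(inj_eq (fmorph_inj rc)) !rmorphM /=.
    by rewrite !ai // mulrAC eqxx.
  move: zs; rewrite (bigD1 i) //= big1 ?addr0 => [/eqP|j /xj0 ->]; last first.
    by rewrite expr0n -(negbK (m == 0%N)) -lt0n m_gt0 mulr0.
  rewrite mulf_eq0 expf_eq0 (negPf xi) andbF orbF coefD coefZ !coef_map => /eqP b0.
  have := inf_simple i; rewrite -(inj_eq (fmorph_inj rc)) !rmorphM /= ai //.
  rewrite -subr_eq0 => /negP[]; apply/eqP.
  transitivity (- (rc (q0 i)`_m + t * rc (q1 i)`_m) * rc (q1 i)`_m.+1); first by ring.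
  by rewrite b0 oppr0 mul0r.
have [D [D0 sD Droot]] := star_discriminant m_gt0 (rc C0) sQ0 sQ1 det_g.
have crit_root t x : singular_point (f + t *: g) x -> t \in map rc ts.
  move=> sing; have xN0 := no_inf _ _ sing.
  have sQ j : (size (Q0 j + t *: Q1 j)%R <= m.+2)%N.
    rewrite (leq_trans (size_polyD _ _)) // geq_max sQ0 /=.
    by rewrite (leq_trans (size_scale_leq _ _)).
  have Dt : root D t.
    by rewrite fgE in sing; apply: Droot (singular_star_critical sQ sing xN0).
  apply: contraT => tN.
  (* A further parameter would give D more roots than its degree allows. *)
  have rts : all (root D) (t :: map rc ts).
    rewrite /= Dt; apply/allP => _ /mapP[u /ts_crit[s [cs sum_s]] ->].
    apply: (Droot _ (fun j => rc (s j))); split=> [j|].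
      rewrite -map_polyZ -rmorphD deriv_map horner_map cs ?rmorph0 //.
    rewrite (eq_bigr (fun j => rc (q0 j + u *: q1 j).[s j])) => [|j _].
      by rewrite -rmorph_sum -rmorphM -!rmorphD sum_s rmorph0.
    by rewrite -map_polyZ -rmorphD horner_map.
  have := max_poly_roots D0 rts; rewrite /= tN map_inj_uniq; last exact: fmorph_inj.
  by move/(_ uniq_ts); rewrite size_map size_ts ltnNge sD.
have FGs t : t \in ts -> exists x, singular_point (F + t *: G) x.
  move=> /ts_crit[s cs]; rewrite FGE; eexists; apply: star_critical_singular cs => // j.
  rewrite (leq_trans (size_polyD _ _)) // geq_max sq0 /=.
  by rewrite (leq_trans (size_scale_leq _ _)).
have fg_sing t : t \in ts -> exists x, singular_point (f + rc t *: g) x.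
  move=> /ts_crit[s [cs sum_s]]; rewrite fgE; eexists.
  apply: (@star_critical_singular _ _ _ _ _ (fun j => rc (s j))) => // [j|].
    rewrite (leq_trans (size_polyD _ _)) // geq_max sQ0 /=.
    by rewrite (leq_trans (size_scale_leq _ _)).
  split=> [j|].
    by rewrite -map_polyZ -rmorphD deriv_map horner_map cs ?rmorph0.
  rewrite (eq_bigr (fun j => rc (q0 j + t *: q1 j).[s j])) => [|j _].
    by rewrite -rmorph_sum -rmorphM -!rmorphD sum_s rmorph0.
  by rewrite -map_polyZ -rmorphD horner_map.
have fgN0 t : f + t *: g != 0.
  apply/eqP => fg0; have [|/eqP] := indep 1 t; first by rewrite scale1r.
  by rewrite oner_eq0.
pose L := complexify_space <<[:: F; G]>>%VS.
have LE : L = <<[:: f; g]>>%VS by apply: complexify_span2.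
pose s := [seq <[f + rc t *: g]>%VS | t <- ts].
have uniq_s : uniq s.
  rewrite map_inj_uniq // => t u eqtu.
  have /vlineP[k] : f + rc t *: g \in <[f + rc u *: g]>%VS by rewrite -eqtu memv_line.
  rewrite scalerDr scalerA => eqk.
  have [|/eqP k1 /eqP] := indep (1 - k) (rc t - k * rc u).
    rewrite !scalerBl scale1r addrACA -opprD -eqk subrr //.
  move: k1; rewrite subr_eq0 => /eqP <-; rewrite mul1r subr_eq0 => /eqP.
  exact: fmorph_inj.
have s_sub H : H \in s -> (H <= L)%VS.
  case/mapP => t _ ->; rewrite LE -memvE; apply/span2P.
  by exists 1, (rc t); rewrite scale1r.
exists L; split.
- split; last by exists <<[:: F; G]>>%VS.
  rewrite LE; suff /eqP -> : free [:: f; g] by [].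
  rewrite free_cons seq1_free span_seq1; apply/andP; split.
    apply/vlineP => -[k fk]; have [|/eqP] := indep 1 (- k).
      by rewrite scale1r scaleNr -fk subrr.
    by rewrite oner_eq0.
  apply/eqP => g0; have [|_ /eqP] := indep 0 1; first by rewrite scale0r scale1r add0r.
  by rewrite oner_eq0.
- exists s; split; rewrite ?size_map // => H; split.
    move=> Hs; split; first exact: s_sub.
    by case/mapP: Hs => t tts ->; exists (f + rc t *: g); split=> //; apply: fg_sing.
  case=> HL [h [hN0 HE [x sing]]].
  have /span2P[a [b hE]] : h \in <<[:: f; g]>>%VS by rewrite -LE memvE -HE.
  (* The case a = 0 is the member at t = infinity. *)
  have [a0|aN0] := eqVneq a 0.
    rewrite a0 scale0r add0r in hE.
    case: (@g_smooth x); apply: (@singular_pointZ _ _ b); last by rewrite -hE.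
    by apply: contraNneq hN0 => b0; rewrite hE b0 scale0r.
  have hE' : h = a *: (f + (b / a) *: g).
    by rewrite scalerDr scalerA mulrCA mulfV // mulr1.
  have sing' : singular_point (f + (b / a) *: g) x.
    by apply: (singular_pointZ aN0); rewrite -hE'.
  have /mapP[t tts bat] := crit_root _ _ sing'.
  apply/mapP; exists t => //; rewrite HE hE' bat; apply/eqP.
  rewrite eqEsubv -!memvE memvZ ?memv_line //=; apply/vlineP.
  by exists a^-1; rewrite scalerA mulVf // scale1r.
- exists s; split; rewrite ?size_map ?size_ts // => H Hs; split; first exact: s_sub.
  case/mapP: Hs => t tts ->; exists (F + t *: G); rewrite cFG; split=> //.
    apply/eqP => FG0; have /eqP := fgN0 (rc t); rewrite -cFG FG0; apply.
    by apply: val_inj; rewrite /= raddf0.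
  exact: FGs.
Qed.

End Pencil.

(** * A real polynomial with distinct critical values *)

Section MorsePolynomial.

Variable R : realType.
Implicit Types (p : {poly R}).

Lemma antiderivative p : exists q : {poly R}, q^`() = p.
Proof.
exists (\poly_(i < (size p).+1) (p`_i.-1 / i%:R)); apply/polyP => i.
rewrite coef_deriv coef_poly ltnS /=.
case: ltnP => [_|le_pi]; last by rewrite mul0rn nth_default.
by rewrite -[LHS]mulr_natr mulfVK // pnatr_eq0.
Qed.

(* Adding a far away critical point c to an antiderivative Q of P replaces it
   by I - c Q, where I' = XP; only finitely many c create a coincidence of
   critical values. *)
Lemma morse_seq m : exists cs : seq R, exists Q : {poly R},
  [/\ size cs = m, uniq cs, all (fun c => 0 < c) cs,
      Q^`() = \prod_(c <- cs) ('X - c%:P) & {in cs &, injective (fun c => Q.[c])}].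
Proof.
elim: m => [|m [cs [Q [sz ucs pos dQ injQ]]]].
  by exists [::], 'X; rewrite big_nil derivX.
pose P : {poly R} := \prod_(c <- cs) ('X - c%:P).
have PN0 : P != 0 by apply/monic_neq0/monic_prod_XsubC.
have [I dI] := antiderivative (P * 'X).
(* As polynomials in the new point c, A compares the values of I - c Q at two old points, and B
   those at c and at an old point. *)
pose A a b : {poly R} := (I.[a] - I.[b])%:P - (Q.[a] - Q.[b]) *: 'X.
pose B a : {poly R} := I - 'X * Q - I.[a]%:P + Q.[a] *: 'X.
have AN0 a b : a \in cs -> b \in cs -> b != a -> A a b != 0.
  move=> acs bcs; apply: contraNneq => /(congr1 (fun p : {poly R} => p`_1)).
  rewrite coefB coefC coefZ coefX mulr1 coef0 sub0r => /eqP.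
  rewrite oppr_eq0 subr_eq0 => /eqP /injQ -> //.
have BN0 a : B a != 0.
  (* Differentiating twice leaves -P for every a, so B cannot vanish identically. *)
  have dB : (B a)^`()^`() = - P.
    rewrite /B !(derivD, derivB, derivM, derivZ, derivC, derivX, derivN) dI dQ -/P.
    by rewrite derivM derivX scaler0; ring.
  by apply: contra_neq PN0 => B0; rewrite -[P]opprK -dB B0 !deriv0 oppr0.
have : P * (\prod_(a <- cs) \prod_(b <- cs | b != a) A a b) *
    \prod_(a <- cs) B a != 0.
  rewrite !mulf_neq0 //; last by rewrite prodf_seq_neq0; apply/allP => a _; apply: BN0.
  rewrite prodf_seq_neq0; apply/allP => a acs; apply/implyP => _.
  rewrite prodf_seq_neq0; apply/allP => b bcs; apply/implyP; exact: AN0.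
case/(poly_nonroot 1) => k k_gt0.
rewrite !hornerM !mulf_eq0 !negb_or => /andP[/andP[Pk Ak] Bk].
pose c : R := k%:R.
have c_gt0 : 0 < c by rewrite ltr0n.
exists (c :: cs), (I - c *: Q).
have cncs : c \notin cs.
  apply: contra Pk => ccs; rewrite -/(root P c) root_prod_XsubC //.
have cA a b : a \in cs -> b \in cs -> b != a ->
    (I - c *: Q).[a] != (I - c *: Q).[b].
  move=> acs bcs ba; rewrite -subr_eq0; move: Ak.
  rewrite horner_prod prodf_seq_neq0 => /allP/(_ a acs) /=.
  rewrite horner_prod prodf_seq_neq0 => /allP/(_ b bcs); rewrite ba /=.
  rewrite !hornerE -/c; apply: contra => /eqP eq0; apply/eqP.
  by rewrite -[RHS]eq0; ring.
have cB a : a \in cs -> (I - c *: Q).[c] != (I - c *: Q).[a].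
  move=> acs; rewrite -subr_eq0; move: Bk.
  rewrite horner_prod prodf_seq_neq0 => /allP/(_ a acs) /=.
  rewrite !hornerE -/c; apply: contra => /eqP eq0; apply/eqP.
  by rewrite -[RHS]eq0; ring.
split; rewrite /= ?sz ?cncs ?ucs ?c_gt0 //.
  by rewrite big_cons derivB derivZ dI dQ -/P -mul_polyC; ring.
move=> a b; rewrite !inE => /predU1P[->|acs] /predU1P[->|bcs] //= eqv.
- by have := cB _ bcs; rewrite eqv eqxx.
- by have := cB _ acs; rewrite eqv eqxx.
- by apply/eqP; apply: contraT; rewrite eq_sym => /(cA _ _ acs bcs); rewrite eqv eqxx.
Qed.

(** The factor m + 1 makes the antiderivative monic; the critical points are nondegenerate because
    they are distinct roots of the product. *)
Lemma morse_poly m : exists S : {poly R}, exists c : 'I_m -> R,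
  [/\ S \is monic, size S = m.+2, forall k, 0 < c k
    & [/\ injective c, injective (fun k => S.[c k]), forall k, S^`().[c k] = 0
      & forall k, S^`()^`().[c k] != 0]].
Proof.
have [cs [Q [sz ucs pos dQ injQ]]] := morse_seq m.
pose P : {poly R} := \prod_(c <- cs) ('X - c%:P).
have sP : size P = m.+1 by rewrite size_prod_XsubC sz.
have mN0 : m.+1%:R != 0 :> R by rewrite pnatr_eq0.
have dE : (m.+1%:R *: Q)^`() = m.+1%:R *: P by rewrite derivZ dQ.
have sQ : size (m.+1%:R *: Q) = m.+2.
  rewrite size_scale //; have := congr1 (size : {poly R} -> nat) dQ.
  rewrite polyorder.size_deriv sP => <-; rewrite prednK // size_poly_gt0.
  apply/eqP => Q0; move: sP; rewrite /P -dQ Q0 deriv0 size_poly0 //.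
pose c (k : 'I_m) := cs`_k.
have cin k : c k \in cs by rewrite mem_nth // sz.
have cI : injective c.
  by move=> k l /eqP; rewrite nth_uniq ?sz // => /eqP /val_inj.
exists (m.+1%:R *: Q), c; split => //.
- rewrite monicE lead_coefE sQ /=.
  have := congr1 (fun p : {poly R} => p`_m) dE; rewrite coef_deriv [in RHS]coefZ => eqm.
  have /eqP Pm : P`_m == 1.
    by have : P \is monic by [apply: monic_prod_XsubC]; rewrite monicE lead_coefE sP.
  move: eqm; rewrite Pm mulr1 -[LHS]mulr_natl => /eqP.
  by rewrite -[X in _ == X]mulr1 (inj_eq (mulfI mN0)).
- by move=> k; apply: (allP pos).
split => // [k l|k|k].
- rewrite /= !hornerZ => /(mulfI mN0) /injQ; rewrite !cin => /(_ isT isT).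
  exact: cI.
- by rewrite dE hornerZ (_ : P.[_] = 0) ?mulr0 //; apply/rootP; rewrite root_prod_XsubC.
- rewrite dE derivZ hornerZ mulf_neq0 // /P.
  rewrite (perm_big _ (perm_to_rem (cin k))) big_cons derivM derivXsubC mul1r /=.
  rewrite hornerD hornerM hornerXsubC subrr mul0r addr0 -/(root _ _).
  by rewrite root_prod_XsubC mem_rem_uniq // inE eqxx.
Qed.

End MorsePolynomial.

(** * Perturbation of extrema *)

Section Crossing.

Variable R : realType.
Implicit Types (p : {poly R}).

Lemma finite_pos_lb (I : finType) (F : I -> R) : (forall i, 0 < F i) ->
  exists2 g : R, 0 < g & forall i, g <= F i.
Proof.
move=> F_gt0; exists (\big[Num.min/1]_i F i); last by move=> i; apply: bigmin_le_cond.
by apply/bigmin_gtP; split.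
Qed.

(** Write p - p(c) = q (X - c). If q(c) were nonzero, q would keep its sign near c and the product
    would be negative on one side of c. *)
Lemma interior_min_deriv p (l r c : R) : l < c < r ->
  (forall x, l <= x <= r -> p.[c] <= p.[x]) -> p^`().[c] = 0.
Proof.
move=> /andP[lc cr] cmin.
have /factor_theorem[q pE] : root (p - p.[c]%:P) c by rewrite /root !hornerE subrr.
have pxE x : p.[x] - p.[c] = q.[x] * (x - c).
  by have := congr1 (horner^~ x) pE; rewrite !hornerE.
have -> : p^`().[c] = q.[c].
  have -> : p^`() = (q * ('X - c%:P) + p.[c]%:P)^`() by rewrite -pE subrK.
  by rewrite derivD derivC derivM derivXsubC !hornerE; ring.
apply/eqP; apply: contraT => qcN0.
have qc_gt0 : 0 < `|q.[c]| by rewrite normr_gt0.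
have [d d_gt0 dP] := polyrcf.poly_cont c q qc_gt0.
pose h := Num.min (d / 2) (Num.min (r - c) (c - l)).
have h_gt0 : 0 < h by rewrite !lt_min !subr_gt0 lc cr divr_gt0.
have [hd hr hl] : [/\ h < d, h <= r - c & h <= c - l].
  by split; rewrite /h ?gt_min ?ge_min ?lexx ?orbT // ltr_pdivrMr // ltr_pMr // ltr1n.
have near x : `|x - c| = h -> 0 <= q.[x] * (x - c).
  move=> xh; rewrite -pxE subr_ge0; apply: cmin.
  have : `|x - c| <= h by rewrite xh.
  by rewrite ler_norml; lra.
have [qc|qc|qc] := ltgtP q.[c] 0; last by rewrite qc eqxx in qcN0.
- have xh : `|c + h - c| = h by rewrite addrC addKr gtr0_norm.
  have := dP (c + h); rewrite xh => /(_ hd); rewrite (ltr0_norm qc) ltr_norml.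
  have := near _ xh; rewrite [c + h - c]addrC addKr pmulr_lge0 //; lra.
- have xh : `|c - h - c| = h by rewrite addrC addKr normrN gtr0_norm.
  have := dP (c - h); rewrite xh => /(_ hd); rewrite (gtr0_norm qc) ltr_norml.
  have := near _ xh; rewrite [c - h - c]addrC addKr mulrN oppr_ge0 pmulr_lle0 //; lra.
Qed.

Lemma poly_argmin p (l r : R) : l <= r ->
  exists2 c, l <= c <= r & forall x, l <= x <= r -> p.[c] <= p.[x].
Proof.
move=> lr; have [|c cin cmin] := @EVT_min R (horner p) l r lr.
  by apply: continuous_subspaceT; apply: continuous_horner.
by exists c; rewrite ?in_itv // in cin * => x xin; apply: cmin; rewrite in_itv.
Qed.

(** Meant for functions given as extremal values, which come with a Lipschitz bound instead of a
    formula. *)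
Lemma lipschitz_ivt (f : R -> R) (M x y : R) : x <= y ->
  (forall u v, `|f u - f v| <= M * `|u - v|) -> f x <= 0 -> 0 <= f y ->
  exists2 z, x <= z <= y & f z = 0.
Proof.
move=> xy lip fx fy; have [||z zin fz] := @IVT R f x y 0 xy; last 1 first.
- by exists z; rewrite // in_itv in zin.
- apply: continuous_subspaceT => u; apply/cvgrPdist_lt => e e_gt0.
  have M_gt0 : 0 < `|M| + 1 by rewrite ltr_wpDl.
  near=> v; apply: le_lt_trans (lip _ _) _.
  apply: (@le_lt_trans _ _ ((`|M| + 1) * `|u - v|)).
    by rewrite ler_wpM2r // (le_trans (ler_norm _)) // lerDl.
  rewrite mulrC -ltr_pdivlMr //.
  by near: v; apply: (@cvgr_dist_lt _ _ _ _ _ id u) => //; apply: divr_gt0.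
- by rewrite ge_min fx /= le_max fy orbT.
Unshelve. all: by end_near. Qed.

(* The function Phi T = b + T a + sum_j ext_[l j, r j] (T A j + B j), whose
   zeros give the solutions, is Lipschitz and changes sign near Ts. *)
Lemma crossing_stable_pos n (A0 B0 : 'I_n -> {poly R}) (a0 b0 Ts mu : R)
    (l r c sg : 'I_n -> R) :
  (forall j, sg j = 1 \/ sg j = -1) ->
  (forall j, l j < c j < r j) ->
  (forall j s, l j <= s <= r j ->
     sg j * (B0 j + Ts *: A0 j).[c j] <= sg j * (B0 j + Ts *: A0 j).[s]) ->
  (forall j, sg j * (B0 j + Ts *: A0 j).[c j] < sg j * (B0 j + Ts *: A0 j).[l j]) ->
  (forall j, sg j * (B0 j + Ts *: A0 j).[c j] < sg j * (B0 j + Ts *: A0 j).[r j]) ->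
  b0 + Ts * a0 + \sum_j (B0 j + Ts *: A0 j).[c j] = 0 ->
  0 < mu ->
  (forall s, (forall j, l j <= s j <= r j) -> mu <= a0 + \sum_j (A0 j).[s j]) ->
  forall e : R, 0 < e -> exists2 eta : R, 0 < eta & forall A B a b,
    (forall j s, l j <= s <= r j -> `|(A j).[s] - (A0 j).[s]| <= eta) ->
    (forall j s, l j <= s <= r j -> `|(B j).[s] - (B0 j).[s]| <= eta) ->
    `|a - a0| <= eta -> `|b - b0| <= eta ->
    exists T s, [/\ `|T - Ts| <= e, forall j, l j < s j < r j
      & star_critical (fun j => B j + T *: A j) (b + T * a) s].
Proof.
move=> sgP lcr cmin cl cr sum0 mu_gt0 slope e e_gt0.
have lr j : l j <= r j by case/andP: (lcr j) => /ltW lc /ltW; apply: le_trans.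
have lc j : l j <= c j <= r j by case/andP: (lcr j) => /ltW -> /ltW ->.
pose M := 1 + \sum_j `|sval (poly_itv_bound (A0 j) (l j) (r j))|.
have M_gt0 : 0 < M by rewrite ltr_pwDl // sumr_ge0.
have A0M j s : l j <= s <= r j -> `|(A0 j).[s]| <= M.
  move=> /(svalP (poly_itv_bound (A0 j) (l j) (r j))) /le_trans-> //.
  rewrite (le_trans (ler_norm _)) // /M (bigD1 j) //= addrCA lerDl.
  by rewrite addr_ge0 // sumr_ge0.
have [gam gam_gt0 gamP] : exists2 gam : R, 0 < gam & forall j,
    gam <= sg j * (B0 j + Ts *: A0 j).[l j] - sg j * (B0 j + Ts *: A0 j).[c j] /\
    gam <= sg j * (B0 j + Ts *: A0 j).[r j] - sg j * (B0 j + Ts *: A0 j).[c j].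
  pose gl j := sg j * (B0 j + Ts *: A0 j).[l j] - sg j * (B0 j + Ts *: A0 j).[c j].
  pose gr j := sg j * (B0 j + Ts *: A0 j).[r j] - sg j * (B0 j + Ts *: A0 j).[c j].
  have [j|gam gam_gt0 gamP] := @finite_pos_lb _ (fun j => Num.min (gl j) (gr j)).
    by rewrite lt_min !subr_gt0 cl cr.
  by exists gam => // j; have := gamP j; rewrite le_min => /andP.
(* Moving T by [e'] changes a block by at most a quarter of the gap [gam], and [kap] below is at
   most an eighth of it; twice the total stays below [gam], so extrema cannot reach the ends. *)
pose e' := Num.min 1 (Num.min e (gam / (4 * M))).
have e'_gt0 : 0 < e' by rewrite !lt_min ltr01 e_gt0 divr_gt0 // mulr_gt0.
have [e'1 e'e e'g] : [/\ e' <= 1, e' <= e & e' * M <= gam / 4].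
  split; rewrite /e' ?ge_min ?lexx ?orbT //.
  rewrite -ler_pdivlMr // -mulrA -invfM.
  by rewrite ?ge_min ?lexx ?orbT.
(* N bounds 1 + |T| when |T - Ts| <= 1, so data within kap / N give values within kap. *)
pose N := `|Ts| + 2.
have N_gt0 : 0 < N by rewrite ltr_wpDl.
(* The n blocks and the constant term each contribute an error [kap]; together these must stay below
   the change e' mu forced by the slope. *)
pose kap := Num.min (gam / 8) (e' * mu / n.+2%:R).
have kap_gt0 : 0 < kap by rewrite lt_min !divr_gt0 // mulr_gt0.
have kapg : kap <= gam / 8 by rewrite /kap ge_min lexx.
have kapm : n.+1%:R * kap < e' * mu.
  apply: (@lt_le_trans _ _ (n.+2%:R * kap)); first by rewrite ltr_pM2r // ltr_nat.
  by rewrite mulrC -ler_pdivlMr // /kap ge_min lexx orbT.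
exists (kap / N); first by rewrite divr_gt0.
move=> A B a b AA0 BB0 aa0 bb0.
pose g T j := B j + T *: A j.
have close T : `|T - Ts| <= e' -> forall x y x0 y0, `|x - x0| <= kap / N ->
    `|y - y0| <= kap / N -> `|(y + T * x) - (y0 + T * x0)| <= kap.
  move=> TTs x y x0 y0 xx yy.
  have -> : y + T * x - (y0 + T * x0) = (y - y0) + T * (x - x0) by ring.
  rewrite (le_trans (ler_normD _ _)) // normrM.
  have TN : 1 + `|T| <= N.
    have : `|T| <= `|T - Ts| + `|Ts| by rewrite -{1}(subrK Ts T) ler_normD.
    rewrite /N; move: TTs e'1; lra.
  apply: (@le_trans _ _ (kap / N + `|T| * (kap / N))).
    by rewrite lerD // ler_wpM2l.
  rewrite -{1}[kap / N]mul1r -mulrDl mulrCA ger_pMr //.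
  by rewrite ler_pdivrMr // mul1r.
have gclose T j s : `|T - Ts| <= e' -> l j <= s <= r j ->
    `|(g T j).[s] - ((B0 j + Ts *: A0 j).[s] + (T - Ts) * (A0 j).[s])| <= kap.
  move=> TTs sin; rewrite /g !hornerD !hornerZ.
  have -> : (B0 j).[s] + Ts * (A0 j).[s] + (T - Ts) * (A0 j).[s] =
    (B0 j).[s] + T * (A0 j).[s] by ring.
  by apply: close; rewrite ?AA0 ?BB0.
(* Only the extremal values have to vary continuously with T, so an arbitrary choice of minimizers
   will do. *)
have /choice[S SP] : forall Tj : R * 'I_n, exists s, l Tj.2 <= s <= r Tj.2 /\
    forall x, l Tj.2 <= x <= r Tj.2 ->
      sg Tj.2 * (g Tj.1 Tj.2).[s] <= sg Tj.2 * (g Tj.1 Tj.2).[x].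
  move=> [T j]; have [s sin smin] := poly_argmin (sg j *: g T j) (lr j).
  by exists s; split=> // x xin; rewrite -!hornerZ; apply: smin.
have Sin T j : l j <= S (T, j) <= r j by case: (SP (T, j)).
have Smin T j x : l j <= x <= r j ->
    sg j * (g T j).[S (T, j)] <= sg j * (g T j).[x].
  by case: (SP (T, j)) => _; apply.
pose Phi T := b + T * a + \sum_j (g T j).[S (T, j)].
pose MA := `|a| + \sum_j `|sval (poly_itv_bound (A j) (l j) (r j))|.
have lip T T' : `|Phi T - Phi T'| <= MA * `|T - T'|.
  have -> : Phi T - Phi T' = (T - T') * a +
      \sum_j ((g T j).[S (T, j)] - (g T' j).[S (T', j)]).
    by rewrite /Phi sumrB; ring.
  rewrite (le_trans (ler_normD _ _)) // normrM mulrDl [_ * `|a|]mulrC lerD2l.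
  rewrite (le_trans (ler_norm_sum _ _ _)) // mulr_suml; apply: ler_sum => j _.
  set K := sval _.
  have KP s : l j <= s <= r j -> `|(A j).[s]| <= `|K|.
    by move=> /(svalP (poly_itv_bound (A j) (l j) (r j))) /le_trans-> //; apply: ler_norm.
  (* Minimality at U is tested with the minimizer for U'; exchanging the two gives the other
     bound. *)
  have half U U' : sg j * (g U j).[S (U, j)] <=
      sg j * (g U' j).[S (U', j)] + `|K| * `|U - U'|.
    apply: le_trans (Smin U j _ (Sin U' j)) _.
    have -> : (g U j).[S (U', j)] = (g U' j).[S (U', j)] + (U - U') * (A j).[S (U', j)].
      by rewrite /g !hornerE; ring.
    rewrite mulrDr lerD2l (le_trans (ler_norm _)) // !normrM.
    have -> : `|sg j| = 1 by case: (sgP j) => ->; rewrite ?normrN normr1.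
    by rewrite mul1r mulrC ler_wpM2r // KP.
  have := half T T'; have := half T' T; rewrite [`|T' - T|]distrC ler_norml.
  by case: (sgP j) => -> h1 h2; clear -h1 h2; apply/andP; split; lra.
have signs (w : R) : w = 1 \/ w = -1 -> 0 <= w * Phi (Ts + w * e').
  move=> wP; set T := Ts + w * e'.
  have TTs : T - Ts = w * e' by rewrite /T addrC addKr.
  have TTs' : `|T - Ts| <= e'.
    by rewrite TTs normrM (gtr0_norm e'_gt0); case: wP => ->; rewrite ?normrN normr1 mul1r.
  (* The test point is the minimizer for T if sg j = w and c j otherwise. The slope hypothesis
     allows any points of the intervals. *)
  have bnd j : exists2 s, l j <= s <= r j &
      e' * (A0 j).[s] - kap <= w * (g T j).[S (T, j)] - w * (B0 j + Ts *: A0 j).[c j].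
    have := cmin j _ (Sin T j); have := Smin T j _ (lc j).
    have := gclose T j _ TTs' (lc j); have := gclose T j _ TTs' (Sin T j).
    rewrite TTs !ler_norml => /andP[h1 h2] /andP[h3 h4].
    case: (sgP j) wP h1 h2 h3 h4 => -> [] -> h1 h2 h3 h4 m1 m2;
      rewrite ?mulN1r ?mul1r in h1 h2 h3 h4 m1 m2 *.
    - exists (S (T, j)); [exact: Sin | clear -h1 m2; lra].
    - exists (c j); [exact: lc | clear -h4 m1; lra].
    - exists (c j); [exact: lc | clear -h3 m1; lra].
    - exists (S (T, j)); [exact: Sin | clear -h2 m2; lra].
  have /choice[s' s'P] : forall j, exists s, l j <= s <= r j /\
      e' * (A0 j).[s] - kap <= w * (g T j).[S (T, j)] - w * (B0 j + Ts *: A0 j).[c j].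
    by move=> j; have [s ? ?] := bnd j; exists s.
  have := slope s' (fun j => (s'P j).1).
  have sums : \sum_j (e' * (A0 j).[s' j] - kap) <=
      \sum_j (w * (g T j).[S (T, j)] - w * (B0 j + Ts *: A0 j).[c j]).
    by apply: ler_sum => j _; apply: (s'P j).2.
  move: sums; rewrite !sumrB -!mulr_sumr sumr_const card_ord => sums.
  have bT := close T TTs' a b a0 b0 aa0 bb0.
  rewrite ler_norml in bT; case/andP: bT => bT1 bT2.
  have TE : T * a0 = Ts * a0 + w * e' * a0 by rewrite /T mulrDl.
  set X := \sum_j (A0 j).[s' j] in sums * => muX.
  set Y := \sum_j (B0 j + _).[c j] in sum0 sums.
  set Z := \sum_j (g T j).[_] in sums.
  have e'mu : e' * mu <= e' * (a0 + X) by rewrite ler_pM2l.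
  rewrite /Phi -/Z; rewrite mulrDr in e'mu; rewrite -[kap *+ n]mulr_natl in sums.
  have kapm' := kapm; rewrite -natr1 mulrDl mul1r in kapm'.
  clear -bT1 bT2 TE sum0 sums e'mu kapm' wP.
  case: wP TE sums => -> TE sums; rewrite ?mul1r ?mulN1r in TE sums *; lra.
have [|||T Tin PhiT] := lipschitz_ivt (x := Ts - e') (y := Ts + e') _ lip.
- by have := e'_gt0; lra.
- by have := signs (-1) (or_intror erefl); rewrite !mulN1r oppr_ge0.
- by have := signs 1 (or_introl erefl); rewrite !mul1r.
have TTs : `|T - Ts| <= e' by rewrite ler_norml; move: Tin; lra.
exists T, (fun j => S (T, j)).
have Sint j : l j < S (T, j) < r j.
  have TA s : l j <= s <= r j -> `|(T - Ts) * (A0 j).[s]| <= gam / 4.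
    move=> sin; rewrite normrM (le_trans _ e'g) // ler_pM //; exact: A0M.
  have lj : l j <= l j <= r j by rewrite lexx lr.
  have rj : l j <= r j <= r j by rewrite lexx lr.
  have [/andP[lS Sr] m] := (Sin T j, Smin T j _ (lc j)).
  have tc := TA _ (lc j); have gc := gclose T j _ TTs (lc j).
  have tl := TA _ lj; have gl := gclose T j _ TTs lj.
  have tr := TA _ rj; have gr := gclose T j _ TTs rj.
  have [g1 g2] := gamP j; rewrite !ler_norml in tc gc tl gl tr gr.
  rewrite !lt_neqAle lS Sr !andbT; apply/andP; split; apply/eqP => eqS.
    rewrite -eqS in m; clear -g1 m tc gc tl gl kapg gam_gt0 sgP.
    by case: (sgP j) g1 m => -> g1 m; rewrite ?mul1r ?mulN1r in g1 m; lra.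
  rewrite eqS in m; clear -g2 m tc gc tr gr kapg gam_gt0 sgP.
  by case: (sgP j) g2 m => -> g2 m; rewrite ?mul1r ?mulN1r in g2 m; lra.
split=> //; first exact: le_trans e'e.
split=> // j; have sgN0 : sg j != 0 by case: (sgP j) => ->; rewrite ?oppr_eq0 oner_eq0.
apply: (mulfI sgN0); rewrite mulr0 -hornerZ -derivZ.
by apply: interior_min_deriv (Sint j) _ => x xin; rewrite !hornerZ Smin.
Qed.

End Crossing.

Section MorseNeighborhood.

Variable R : realType.

(* Replacing T, A and a by their opposites reduces om = -1 to om = 1. *)
Lemma crossing_stable n (A0 B0 : 'I_n -> {poly R}) (a0 b0 Ts mu om : R)
    (l r c sg : 'I_n -> R) :
  (forall j, sg j = 1 \/ sg j = -1) ->
  (forall j, l j < c j < r j) ->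
  (forall j s, l j <= s <= r j ->
     sg j * (B0 j + Ts *: A0 j).[c j] <= sg j * (B0 j + Ts *: A0 j).[s]) ->
  (forall j, sg j * (B0 j + Ts *: A0 j).[c j] < sg j * (B0 j + Ts *: A0 j).[l j]) ->
  (forall j, sg j * (B0 j + Ts *: A0 j).[c j] < sg j * (B0 j + Ts *: A0 j).[r j]) ->
  b0 + Ts * a0 + \sum_j (B0 j + Ts *: A0 j).[c j] = 0 ->
  om = 1 \/ om = -1 -> 0 < mu ->
  (forall s, (forall j, l j <= s j <= r j) ->
     mu <= om * (a0 + \sum_j (A0 j).[s j])) ->
  forall e : R, 0 < e -> exists2 eta : R, 0 < eta & forall A B a b,
    (forall j s, l j <= s <= r j -> `|(A j).[s] - (A0 j).[s]| <= eta) ->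
    (forall j s, l j <= s <= r j -> `|(B j).[s] - (B0 j).[s]| <= eta) ->
    `|a - a0| <= eta -> `|b - b0| <= eta ->
    exists T s, [/\ `|T - Ts| <= e, forall j, l j < s j < r j
      & star_critical (fun j => B j + T *: A j) (b + T * a) s].
Proof.
move=> sgP lcr cmin cl cr sum0 omP mu_gt0 slope e e_gt0.
have om2 : om * om = 1 by case: omP => ->; rewrite ?mulrNN mulr1.
have omn (x : R) : `|om * x| = `|x|.
  by case: omP => ->; rewrite ?mulN1r ?normrN // mul1r.
have BAE j : B0 j + (om * Ts) *: (om *: A0 j) = B0 j + Ts *: A0 j.
  by rewrite scalerA mulrAC om2 mul1r.
have [j s sin|j|j|||eta eta_gt0 etaP] :=
  @crossing_stable_pos R n (fun j => om *: A0 j) B0 (om * a0) b0 (om * Ts) mu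
    l r c sg sgP lcr _ _ _ _ mu_gt0 _ e e_gt0.
- by rewrite !BAE; apply: cmin.
- by rewrite !BAE; apply: cl.
- by rewrite !BAE; apply: cr.
- rewrite (eq_bigr (fun j => (B0 j + Ts *: A0 j).[c j])) => [|j _]; last by rewrite BAE.
  by rewrite mulrACA om2 mul1r.
- move=> s sin; apply: le_trans (slope s sin) _; rewrite mulrDr mulr_sumr.
  by rewrite lerD2l ler_sum // => j _; rewrite hornerZ.
exists eta => // A B a b AA0 BB0 aa0 bb0.
have [||T [s [TTs sin crit]]] := etaP (fun j => om *: A j) B (om * a) b _ BB0 _ bb0.
- by move=> j s sin; rewrite !hornerZ -mulrBr omn AA0.
- by rewrite -mulrBr omn.
exists (om * T), s; split=> //.
  by rewrite -omn mulrBr mulrA om2 mul1r.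
case: crit => cr0 su0; split=> [j|].
  by rewrite -[RHS](cr0 j) scalerA [T * om]mulrC.
rewrite -[RHS]su0 mulrCA mulrA; congr (_ + _ * _ + _); apply: eq_bigr => j _.
by rewrite scalerA [T * om]mulrC.
Qed.

(** Near a critical point S = S(c) + q (X - c)^2 with q(c) nonzero, and the sign of q(c) tells
    minima from maxima. The bound eta < c k keeps the intervals positive, so that they can be
    inverted later. *)
Lemma morse_nbhd m (S : {poly R}) (c : 'I_m -> R) (kap : R) : 0 < kap ->
  (forall k, 0 < c k) -> (forall k, S^`().[c k] = 0) ->
  (forall k, S^`()^`().[c k] != 0) ->
  exists eta : R, exists sg : 'I_m -> R,
    [/\ 0 < eta, forall k, eta < c k, forall k, sg k = 1 \/ sg k = -1,
        forall k s, `|s - c k| <= eta -> s != c k ->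
          sg k * S.[c k] < sg k * S.[s]
      & forall k s, `|s - c k| <= eta -> `|S.[s] - S.[c k]| <= kap].
Proof.
move=> kap_gt0 c_gt0 dS ddS.
have /choice[q qP] : forall k, exists q : {poly R}, [/\ q.[c k] != 0 &
    forall s, S.[s] = S.[c k] + q.[s] * (s - c k) ^+ 2].
  move=> k; set x := c k.
  have /factor_theorem[q1 q1E] : root (S - S.[x]%:P) x by rewrite /root !hornerE subrr.
  have SE : S = q1 * ('X - x%:P) + S.[x]%:P by rewrite -q1E subrK.
  have dSE : S^`() = q1^`() * ('X - x%:P) + q1.
    by rewrite [in LHS]SE derivD derivC derivM derivXsubC addr0 mulr1.
  have /factor_theorem[q2 q2E] : root q1 x.
    by rewrite /root -(dS k) dSE hornerD hornerM hornerXsubC subrr mulr0 add0r.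
  exists q2; split=> [|s]; last first.
    rewrite {1}SE q2E !(hornerD, hornerM, hornerXsubC, hornerC, hornerN, hornerX).
    by rewrite addrC expr2 mulrA.
  have dq1 : q1^`().[x] = q2.[x].
    by rewrite q2E derivM derivXsubC hornerD hornerM hornerXsubC subrr mulr0 mulr1 add0r.
  apply: contraNneq (ddS k) => q20; rewrite dSE derivD derivM derivXsubC mulr1.
  by rewrite !hornerD hornerM hornerXsubC subrr mulr0 add0r dq1 q20 addr0.
have /choice[d dP] : forall k, exists d : R, [/\ 0 < d, d < c k &
    forall s, `|s - c k| <= d -> 0 < Num.sg (q k).[c k] * (q k).[s] /\
      `|S.[s] - S.[c k]| <= kap].
  move=> k; have [qkN0 _] := qP k.
  have qk_gt0 : 0 < `|(q k).[c k]| by rewrite normr_gt0.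
  have [d1 d1_gt0 d1P] := polyrcf.poly_cont (c k) (q k) qk_gt0.
  have [d2 d2_gt0 d2P] := polyrcf.poly_cont (c k) S kap_gt0.
  exists (Num.min (c k / 2) (Num.min (d1 / 2) (d2 / 2))).
  have half (x : R) : 0 < x -> x / 2 < x by move=> ?; lra.
  split; first by rewrite !lt_min !divr_gt0.
    by rewrite gt_min half.
  move=> s; rewrite !le_min => /and3P[_ sd1 sd2]; split; last first.
    by rewrite ltW // d2P // (le_lt_trans sd2) ?half.
  have := d1P s (le_lt_trans sd1 (half _ d1_gt0)); rewrite ltr_norml => /andP[h1 h2].
  have [qneg|qpos|q0] := ltgtP (q k).[c k] 0; last by rewrite q0 eqxx in qkN0.
    by rewrite ltr0_sg // mulN1r oppr_gt0; rewrite ltr0_norm // in h2; lra.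
  by rewrite gtr0_sg // mul1r; rewrite gtr0_norm // in h1; lra.
have [k|eta eta_gt0 etaP] := @finite_pos_lb R _ d; first by case: (dP k).
exists eta, (fun k => Num.sg (q k).[c k]); split=> // [k|k|k s sk sN|k s sk].
- by case: (dP k) => _ dc _; apply: le_lt_trans dc.
- have [qkN0 _] := qP k.
  have [qneg|qpos|q0] := ltgtP (q k).[c k] 0; last by rewrite q0 eqxx in qkN0.
    by right; rewrite ltr0_sg.
  by left; rewrite gtr0_sg.
- have [_ SE] := qP k; have [_ _ /(_ s (le_trans sk (etaP k)))[qs _]] := dP k.
  rewrite [in ltRHS]SE mulrDr ltrDl mulrA mulr_gt0 //.
  by rewrite exprn_even_gt0 //= subr_eq0.
- by have [_ _ /(_ s (le_trans sk (etaP k)))[]] := dP k.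
Qed.

Lemma poly_nonroot_family (I : finType) (F : I -> {poly R}) (B : R) :
  (forall i, F i != 0) -> exists2 x : R, B < x & forall i, (F i).[x] != 0.
Proof.
move=> FN0; have : \prod_i F i != 0 by apply/prodf_neq0.
case/(poly_nonroot (Num.bound `|B|)) => k Bk; rewrite horner_prod => /prodf_neq0 Fk.
exists k%:R => [|i]; last exact: Fk.
apply: le_lt_trans (ler_norm _) _; apply: lt_le_trans (archi_boundP (normr_ge0 B)) _.
by rewrite ler_nat.
Qed.

End MorseNeighborhood.

(** * Properties that hold for all small positive delta *)

Section DeltaFamilies.

Variable R : realType.

Definition eventually0 (P : R -> Prop) :=
  exists2 d0 : R, 0 < d0 & forall d, 0 < d <= d0 -> P d.

Lemma eventually0_and P Q : eventually0 P -> eventually0 Q ->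
  eventually0 (fun d => P d /\ Q d).
Proof.
move=> [p p_gt0 pP] [q q_gt0 qQ]; exists (Num.min p q); first by rewrite lt_min p_gt0.
by move=> d; rewrite le_min => /and3P[d_gt0 dp dq];
  split; [apply: pP | apply: qQ]; rewrite d_gt0.
Qed.

Lemma eventually0_forall (I : finType) (P : I -> R -> Prop) :
  (forall i, eventually0 (P i)) -> eventually0 (fun d => forall i, P i d).
Proof.
move=> evP; have /choice[d0 d0P] : forall i, exists d0 : R, 0 < d0 /\
    forall d, 0 < d <= d0 -> P i d by move=> i; have [d0 ? ?] := evP i; exists d0.
have [i|g g_gt0 gP] := @finite_pos_lb R _ d0; first by case: (d0P i).
exists g => // d /andP[d_gt0 dg] i; case: (d0P i) => _; apply.
by rewrite d_gt0 (le_trans dg).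
Qed.

Lemma eventually0_imp (P Q : R -> Prop) :
  (forall d, 0 < d -> P d -> Q d) -> eventually0 P -> eventually0 Q.
Proof.
move=> PQ [d0 d0_gt0 evP]; exists d0 => // d din; apply: PQ; last exact: evP.
by case/andP: din.
Qed.

Lemma eventually0_small (K e : R) : 0 < e -> eventually0 (fun d => d <= 1 /\ d * K <= e).
Proof.
move=> e_gt0; have K_gt0 : 0 < `|K| + 1 by rewrite ltr_wpDl.
exists (Num.min 1 (e / (`|K| + 1))); first by rewrite lt_min ltr01 divr_gt0.
move=> d; rewrite le_min ler_pdivlMr // => /and3P[d_gt0 d1 dK]; split=> //.
by apply: le_trans dK; rewrite ler_pM2l // (le_trans (ler_norm _)) // lerDl.
Qed.

Lemma eventually0_small_exp (K e : R) k : 0 < e -> eventually0 (fun d => d ^+ k.+1 * K <= e).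
Proof.
move=> /(eventually0_small `|K|); apply: eventually0_imp => d d_gt0 [d1 dK].
apply: le_trans dK; apply: le_trans (ler_norm _) _; rewrite normrM ler_wpM2r //.
by rewrite normrX gtr0_norm // exprS ger_pMr // exprn_ile1 // ltW.
Qed.

(* As 0 ^+ 0 = 1, at d = 0 exactly the terms with e i = 0 remain. *)
Definition scaled_poly N (a : nat -> R) (e : nat -> nat) (d : R) : {poly R} :=
  \poly_(i < N) (a i * d ^+ e i).

(** Termwise, |d^e - 0^e| <= d for 0 < d <= 1. *)
Lemma scaled_poly_cvg N a e (l r eta : R) : 0 < eta ->
  eventually0 (fun d => forall s, l <= s <= r ->
    `|(scaled_poly N a e d).[s] - (scaled_poly N a e 0).[s]| <= eta).
Proof.
move=> eta_gt0; pose B i := `|sval (poly_itv_bound ('X^i : {poly R}) l r)|.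
have BP i s : l <= s <= r -> `|s ^+ i| <= B i.
  move=> /(svalP (poly_itv_bound ('X^i : {poly R}) l r)); rewrite hornerXn.
  by move/le_trans; apply; apply: ler_norm.
apply: (eventually0_imp _ (eventually0_small (\sum_(i < N) `|a i| * B i) eta_gt0)) =>
  d d_gt0 [d1 dK] s sin.
rewrite !horner_poly -sumrB (le_trans (ler_norm_sum _ _ _)) //.
apply: le_trans dK; rewrite mulr_sumr ler_sum // => i _.
rewrite -mulrBl -mulrBr !normrM mulrA ler_pM ?BP ?mulr_ge0 //.
rewrite mulrC ler_wpM2r //; case: (e i) => [|k]; first by rewrite subrr normr0 ltW.
rewrite expr0n subr0 normrX gtr0_norm // exprS ger_pMr // exprn_ile1 // ltW //.
Qed.

End DeltaFamilies.

(** * The two scales *)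

Section TwoScales.

Variables (R : realType) (n m : nat) (S : {poly R}) (c : 'I_m -> R).
Variables (w : 'I_n -> R) (H : R).
Hypotheses (S_monic : S \is monic) (size_S : size S = m.+2).
Hypotheses (w_gt0 : forall j, 0 < w j) (H_gt0 : 0 < H).
Local Notation T := {ffun 'I_n -> 'I_m}.

Definition tau (j : 'I_n) : R := j%:R.

(** The polynomial (d z)^(m+1) S(1 / (d z)), written by coefficients so as to make sense at d = 0,
    where it is the constant 1. *)
Definition recipS (d : R) := scaled_poly m.+2 (fun k => S`_(m.+1 - k)) id d.

(** The polynomial d^(m+1) S(z / d), which tends to z^(m+1). *)
Definition scaledS (d : R) := scaled_poly m.+2 (fun k => S`_k) (fun k => m.+1 - k)%N d.

Definition base (d : R) (j : 'I_n) : {poly R} :=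
  - (tau j * w j) *: S + H *: recipS d.

Definition slope (j : 'I_n) : {poly R} := w j *: S.

(** At d = 0 this cancels the constants H of all blocks but one. *)
Definition base0 : R := - (n.-1%:R * H).

Lemma lead_S : S`_m.+1 = 1.
Proof. by move: S_monic; rewrite monicE lead_coefE size_S => /eqP. Qed.

Lemma recipS_lim s : (recipS 0).[s] = 1.
Proof.
rewrite horner_poly big_ord_recl expr0 !mulr1 subn0 lead_S big1 ?addr0 // => k _.
by rewrite /= /bump /= exprS !mul0r mulr0 mul0r.
Qed.

Lemma scaledS_lim s : (scaledS 0).[s] = s ^+ m.+1.
Proof.
rewrite horner_poly big_ord_recr /= subnn lead_S expr0 !mul1r big1 ?add0r // => k _.
by rewrite expr0n subn_eq0 leqNgt ltn_ord mulr0 mul0r.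
Qed.

Lemma recipS_inv u : u != 0 -> (recipS 1).[u^-1] * u ^+ m.+1 = S.[u].
Proof.
move=> u0; rewrite horner_poly (horner_coef_wide _ (_ : (size S <= m.+2)%N)) ?size_S //.
rewrite mulr_suml (reindex_inj rev_ord_inj) /=; apply: eq_bigr => k _.
rewrite subSS (subKn (ltnSE (ltn_ord k))) expr1n mulr1 -mulrA; congr (_ * _).
have -> : u ^+ m.+1 = u ^+ (m.+1 - k) * u ^+ k.
  by rewrite -exprD (subnK (ltnSE (ltn_ord k))).
by rewrite exprVn mulrA mulVf ?mul1r // expf_neq0.
Qed.

Lemma coef_comp_scaleX (p : {poly R}) d k :
  (p \Po (d *: 'X))`_k = p`_k * d ^+ k.
Proof.
rewrite comp_polyE coef_sum; case: (ltnP k (size p)) => kp; last first.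
  rewrite nth_default // mul0r big1 // => i _.
  rewrite exprZn !coefZ coefXn (gtn_eqF (leq_trans (ltn_ord i) kp)) !mulr0 //.
rewrite (bigD1 (Ordinal kp)) //= exprZn !coefZ coefXn eqxx mulr1 big1 ?addr0 // => i ik.
rewrite exprZn !coefZ coefXn eq_sym (_ : (i : nat) == k = false) ?mulr0 //.
by apply/negbTE; apply: contra ik => /eqP ik; apply/eqP/val_inj.
Qed.

Lemma recipS_comp d : recipS 1 \Po (d *: 'X) = recipS d.
Proof.
apply/polyP => k; rewrite coef_comp_scaleX !coef_poly; case: ifP => _; last by rewrite mul0r.
by rewrite expr1n mulr1.
Qed.

Lemma scaledS_comp d : scaledS d \Po (d *: 'X) = d ^+ m.+1 *: S.
Proof.
apply/polyP => k; rewrite coef_comp_scaleX coefZ !coef_poly; case: ltnP => km.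
  by rewrite -mulrA -exprD subnK // mulrC.
by rewrite mul0r nth_default ?mulr0 // size_S.
Qed.

Variables (eta : R) (sg : 'I_m -> R).
Hypotheses (eta_gt0 : 0 < eta) (eta_c : forall k, eta < c k).
Hypothesis sgP : forall k, sg k = 1 \/ sg k = -1.
Hypothesis sg_min : forall k s, `|s - c k| <= eta -> s != c k ->
  sg k * S.[c k] < sg k * S.[s].

Lemma sg_minW k s : c k - eta <= s <= c k + eta -> sg k * S.[c k] <= sg k * S.[s].
Proof.
move=> sin; have [->//|sN] := eqVneq s (c k).
by rewrite ltW // sg_min // ler_distl.
Qed.

Lemma sg_min_end k : sg k * S.[c k] < sg k * S.[c k - eta] /\
  sg k * S.[c k] < sg k * S.[c k + eta].
Proof.
have eta_neq : eta != 0 by rewrite gt_eqF.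
split; apply: sg_min.
- by rewrite addrC addKr normrN gtr0_norm.
- by rewrite -subr_eq0 addrC addKr oppr_eq0.
- by rewrite addrC addKr gtr0_norm.
- by rewrite -subr_eq0 addrC addKr.
Qed.

Lemma sgM_sgr k (x : R) : x != 0 -> sg k * Num.sg x = 1 \/ sg k * Num.sg x = -1.
Proof.
move=> xN0; have [x_lt0|x_gt0|x0] := ltgtP x 0; last by rewrite x0 eqxx in xN0.
  by rewrite ltr0_sg // mulrN1; case: (sgP k) => ->; rewrite ?opprK; [right|left].
by rewrite gtr0_sg // mulr1.
Qed.

(* Multiplying S by x w_j turns the extrema of type sg k into extrema of type
   sg k * Num.sg x. *)
Lemma sgr_ext k j (x y a b : R) : x != 0 -> sg k * a <= sg k * b ->
  sg k * Num.sg x * (x * w j * a + y) <= sg k * Num.sg x * (x * w j * b + y).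
Proof.
move=> xN0 ab; rewrite !mulrDr lerD2r.
have E z : sg k * Num.sg x * (x * w j * z) = (`|x| * w j) * (sg k * z).
  by rewrite normrEsg; ring.
by rewrite !E ler_pM2l // mulr_gt0 // normr_gt0.
Qed.

Lemma sgr_ext_lt k j (x y a b : R) : x != 0 -> sg k * a < sg k * b ->
  sg k * Num.sg x * (x * w j * a + y) < sg k * Num.sg x * (x * w j * b + y).
Proof.
move=> xN0 ab; rewrite !mulrDr ltrD2r.
have E z : sg k * Num.sg x * (x * w j * z) = (`|x| * w j) * (sg k * z).
  by rewrite normrEsg; ring.
by rewrite !E ltr_pM2l // mulr_gt0 // normr_gt0.
Qed.

(** At d = 0, with the critical points c (s j), the equation for t is affine: this is its slope and
    [far_root] its zero. *)
Definition far_slope (s : T) : R := 1 + \sum_j w j * S.[c (s j)].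

Definition far_root (s : T) : R :=
  (\sum_j tau j * w j * S.[c (s j)] - H) / far_slope s.

Definition solution (d t : R) : Prop :=
  exists x, star_critical (fun j => base d j + t *: slope j) (base0 + t * 1) x.

(** At d = 0 block j is (t - tau j) w_j S + H, with the extrema of S as long as t differs from
    [tau j]. The bound on [kap] keeps the slope above half of |far_slope| on the whole intervals, so
    the crossing persists for small d. *)
Lemma far_solution kap (s : T) (e : R) : (0 < n)%N ->
  (forall k u, `|u - c k| <= eta -> `|S.[u] - S.[c k]| <= kap) ->
  far_slope s != 0 -> kap * \sum_j w j <= `|far_slope s| / 2 ->
  (forall j, far_root s != tau j) -> 0 < e ->
  eventually0 (fun d => exists2 t, `|t - far_root s| <= e & solution d t).
Proof.
move=> n_gt0 S_close slopeN0 kapP rootN e_gt0.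
set t := far_root s in rootN *; set b := far_slope s in slopeN0 kapP *.
have tN0 j : t - tau j != 0 by rewrite subr_eq0.
have evE d j u : (base d j + t *: slope j).[u] =
    (t - tau j) * w j * S.[u] + H * (recipS d).[u].
  by rewrite !hornerD !hornerZ; ring.
have ev0E j u : (base 0 j + t *: slope j).[u] = (t - tau j) * w j * S.[u] + H.
  by rewrite evE recipS_lim mulr1.
pose om := Num.sg b.
have omP : om = 1 \/ om = -1.
  have [b_lt0|b_gt0|b0] := ltgtP b 0; last by rewrite b0 eqxx in slopeN0.
    by right; rewrite /om ltr0_sg.
  by left; rewrite /om gtr0_sg.
have [||||||||etab etab_gt0 etabP] := @crossing_stable R n slope (base 0) 1 base0 t
    (`|b| / 2) om (fun j => c (s j) - eta) (fun j => c (s j) + eta)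
    (fun j => c (s j)) (fun j => sg (s j) * Num.sg (t - tau j)) _ _ _ _ _ _ omP _ _ e e_gt0.
- by move=> j; apply: sgM_sgr.
- by move=> j; rewrite ltrDl eta_gt0 ltrBlDr ltrDl eta_gt0.
- by move=> j u uin; rewrite !ev0E; apply: sgr_ext => //; apply: sg_minW.
- by move=> j; rewrite !ev0E; apply: sgr_ext_lt => //; case: (sg_min_end (s j)).
- by move=> j; rewrite !ev0E; apply: sgr_ext_lt => //; case: (sg_min_end (s j)).
- rewrite (eq_bigr _ (fun j _ => ev0E j _)) big_split /= sumr_const card_ord.
  have -> : \sum_j (t - tau j) * w j * S.[c (s j)] =
      t * (b - 1) - \sum_j tau j * w j * S.[c (s j)].
    have -> : b - 1 = \sum_j w j * S.[c (s j)] by rewrite /b /far_slope addrAC subrr add0r.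
    rewrite mulr_sumr -sumrB.
    by apply: eq_bigr => j _; ring.
  have tb : t * b = \sum_j tau j * w j * S.[c (s j)] - H by rewrite mulfVK.
  have -> : H *+ n = (n.-1%:R + 1) * H by rewrite natr1 prednK // mulr_natl.
  rewrite mulrBr tb /base0; ring.
- by rewrite divr_gt0 // normr_gt0.
- move=> u uin.
  have -> : om * (1 + \sum_j (slope j).[u j]) =
      `|b| + om * \sum_j w j * (S.[u j] - S.[c (s j)]).
    rewrite normrEsg -/om -mulrDr; congr (_ * _).
    rewrite /b /far_slope -addrA -big_split /=; congr (_ + _).
    by apply: eq_bigr => j _; rewrite hornerZ; ring.
  have : `|om * \sum_j w j * (S.[u j] - S.[c (s j)])| <= `|b| / 2.
    apply: le_trans kapP; rewrite normrM.
    have -> : `|om| = 1 by case: omP => ->; rewrite ?normrN normr1.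
    rewrite mul1r (le_trans (ler_norm_sum _ _ _)) // mulr_sumr ler_sum // => j _.
    rewrite normrM gtr0_norm // mulrC ler_pM2r // S_close //.
    by have := uin j; rewrite ler_distl.
  by rewrite ler_norml => /andP[h _]; move: h; set z := om * _; lra.
have ev_close : eventually0 (fun d => forall j u, c (s j) - eta <= u <= c (s j) + eta ->
    `|(recipS d).[u] - (recipS 0).[u]| <= etab / H).
  by apply: eventually0_forall => j; apply: scaled_poly_cvg; apply: divr_gt0.
apply: (eventually0_imp _ ev_close) => d d_gt0 dP.
have [||||t' [x [t't xin crit]]] := etabP slope (base d) 1 base0.
- by move=> j u uin; rewrite subrr normr0 ltW.
- move=> j u uin; rewrite /base !hornerD !hornerZ opprD addrACA subrr add0r.
  by rewrite -mulrBr normrM gtr0_norm // mulrC -ler_pdivlMr //; apply: (dP j).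
- by rewrite subrr normr0 ltW.
- by rewrite subrr normr0 ltW.
by exists t' => //; exists x.
Qed.

(** What the constant term and the blocks other than i contribute at t = tau i and d = 0; block i
    has to take the opposite critical value. *)
Definition near_level (i : 'I_n) (s : T) : R :=
  tau i + \sum_(j | j != i) (tau i - tau j) * w j * S.[c (s j)].

(** A critical point u and value v of S + th x^(m+1), recorded as the interior extremum that
    [crossing_stable] asks for. *)
Definition extremal (k : 'I_m) (th u v : R) : Prop :=
  [/\ c k - eta < u < c k + eta, v = S.[u] + th * u ^+ m.+1,
      forall x, c k - eta <= x <= c k + eta ->
        sg k * v <= sg k * (S.[x] + th * x ^+ m.+1),
      sg k * v < sg k * (S.[c k - eta] + th * (c k - eta) ^+ m.+1)
    & sg k * v < sg k * (S.[c k + eta] + th * (c k + eta) ^+ m.+1)].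

(** Put t = tau i + d^(m+1) x and z_i = y / d. Block i tends to H y^(m+1) S(1 / y) + x w_i y^(m+1).
    With Y the near level, a critical point y = 1 / u of value -Y means that -x w_i / H is the
    critical value at u of S + (Y / H) X^(m+1). *)
Lemma near_solution (i : 'I_n) (s : T) (u v e : R) :
  (forall j, j != i -> tau i != tau j) ->
  extremal (s i) (near_level i s / H) u v -> 0 < e ->
  eventually0 (fun d => exists2 x, `|x + H * v / w i| <= e &
    solution d (tau i + d ^+ m.+1 * x)).
Proof.
move=> tau_ne [uin vE vmin vl vr] e_gt0; set k := s i in uin vE vmin vl vr *.
set Y := near_level i s in vE vmin vl vr *.
set t := - (H * v / w i).
have u_gt0 : 0 < u by case/andP: uin => lu _; apply: le_lt_trans lu; rewrite subr_ge0 ltW.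
have cm_gt0 : 0 < c k - eta by rewrite subr_gt0.
have cp_gt0 : 0 < c k + eta by rewrite addr_gt0 // (lt_trans eta_gt0).
(* The rescaled data, with x as parameter. At d = 0 only block i depends on x, and its slope w_i
   y^(m+1) is smallest at y = (c k + eta)^-1. *)
pose A d j : {poly R} := if j == i then w i *: scaledS d else (d ^+ m.+1 * w j) *: S.
pose B d j : {poly R} := if j == i then H *: recipS 1
  else ((tau i - tau j) * w j) *: S + H *: recipS d.
pose l j := if j == i then (c k + eta)^-1 else c (s j) - eta.
pose r j := if j == i then (c k - eta)^-1 else c (s j) + eta.
pose z j := if j == i then u^-1 else c (s j).
pose sgz j := if j == i then sg k else sg (s j) * Num.sg (tau i - tau j).
have tN0 j : j != i -> tau i - tau j != 0 by move=> ji; rewrite subr_eq0 tau_ne.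
have wi0 : w i != 0 by rewrite gt_eqF.
(* In the inverse variable block i is a positive multiple of the auxiliary function minus v, shifted
   by -Y: an extremum of value v becomes one of the same type of value -Y. *)
have ev_i y : 0 < y -> (B 0 i + t *: A 0 i).[y^-1] =
    (S.[y] + Y / H * y ^+ m.+1 - v) * (H / y ^+ m.+1) - Y.
  move=> y_gt0; have y0 : y != 0 by rewrite gt_eqF.
  have yd : y ^+ m.+1 != 0 by rewrite expf_neq0.
  rewrite /A /B eqxx !hornerD !hornerZ scaledS_lim -(recipS_inv y0) exprVn /t.
  have H0 : H != 0 by rewrite gt_eqF.
  by field; rewrite wi0 yd H0.
have ev_j j y : j != i -> (B 0 j + t *: A 0 j).[y] = (tau i - tau j) * w j * S.[y] + H.
  move=> /negPf ji; rewrite /A /B ji !hornerD !hornerZ recipS_lim expr0n /=.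
  by rewrite !(mul0r, mulr0, addr0, mulr1).
have inv_in y : (c k + eta)^-1 <= y <= (c k - eta)^-1 ->
    0 < y^-1 /\ c k - eta <= y^-1 <= c k + eta.
  move=> /andP[ly yr]; have y_gt0 : 0 < y by apply: lt_le_trans ly; rewrite invr_gt0.
  split; first by rewrite invr_gt0.
  by rewrite -[c k - eta]invrK -[c k + eta]invrK !lef_pV2 ?posrE ?invr_gt0 // yr.
have Hyd y : 0 < y -> 0 < H / y ^+ m.+1 by move=> y_gt0; rewrite divr_gt0 // exprn_gt0.
have cmp (p q a b : R) : 0 < q -> p = 1 \/ p = -1 -> p * v <= p * a ->
    p * - Y <= p * ((a - v) * q - Y).
  move=> q_gt0 pP pa; rewrite mulrBr [p * - Y]mulrN lerDr mulrA mulr_ge0 ?(ltW q_gt0) //.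
  by rewrite mulrBr subr_ge0.
have cmp_lt (p q a : R) : 0 < q -> p * v < p * a -> p * - Y < p * ((a - v) * q - Y).
  move=> q_gt0 pa; rewrite mulrBr [p * - Y]mulrN ltrDr mulrA mulr_gt0 //.
  by rewrite mulrBr subr_gt0.
have evu : (B 0 i + t *: A 0 i).[u^-1] = - Y by rewrite ev_i // -vE subrr mul0r add0r.
have [|||||||||etab etab_gt0 etabP] := @crossing_stable R n (A 0) (B 0) 0
    (base0 + tau i) t (w i * (c k + eta)^-1 ^+ m.+1) 1 l r z sgz _ _ _ _ _ _ _ _ _ e e_gt0.
- move=> j; rewrite /sgz; case: ifP => [_|/negbT ji]; first exact: sgP.
  by apply: sgM_sgr; apply: tN0.
- move=> j; rewrite /l /r /z; case: ifP => _; last first.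
    by rewrite ltrDl eta_gt0 ltrBlDr ltrDl eta_gt0.
  by case/andP: uin => lu ur; rewrite !ltf_pV2 ?posrE // lu ur.
- move=> j y; rewrite /l /r /z /sgz; have [->|ji] := eqVneq j i; last first.
    by move=> yin; rewrite !ev_j //; apply: sgr_ext; [apply: tN0 | apply: sg_minW].
  move=> /inv_in[y_gt0 yin]; rewrite evu -[y]invrK ev_i //.
  by apply: cmp; [exact: 0 | apply: Hyd | apply: sgP | apply: vmin].
- move=> j; rewrite /l /z /sgz; have [->|ji] := eqVneq j i; last first.
    rewrite !ev_j //; apply: sgr_ext_lt; first exact: tN0.
    by case: (sg_min_end (s j)).
  by rewrite evu ev_i //; apply: cmp_lt => //; apply: Hyd.
- move=> j; rewrite /r /z /sgz; have [->|ji] := eqVneq j i; last first.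
    rewrite !ev_j //; apply: sgr_ext_lt; first exact: tN0.
    by case: (sg_min_end (s j)).
  by rewrite evu ev_i //; apply: cmp_lt => //; apply: Hyd.
- rewrite mulr0 addr0 (bigD1 i) //= /z eqxx evu.
  rewrite (eq_bigr (fun j => (tau i - tau j) * w j * S.[c (s j)] + H)) => [|j ji].
    rewrite big_split /= sumr_const (cardC1 i) card_ord /Y /near_level /base0.
    by rewrite -[H *+ _]mulr_natl; ring.
  by rewrite (negPf ji) ev_j.
- by left.
- by rewrite mulr_gt0 // exprn_gt0 // invr_gt0.
- move=> y yin; rewrite mul1r add0r (bigD1 i) //= big1 => [|j /negPf ji].
    rewrite addr0 /A eqxx hornerZ scaledS_lim ler_pM2l //.
    have := yin i; rewrite /l /r eqxx => /andP[ly _].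
    have inv_gt0 : 0 < (c k + eta)^-1 by rewrite invr_gt0.
    by apply: lerXn2r; rewrite ?nnegrE ?(ltW inv_gt0) // (le_trans (ltW inv_gt0)).
  by rewrite /A ji expr0n mul0r scale0r horner0.
have evS : eventually0 (fun d => forall y, l i <= y <= r i ->
    `|(scaledS d).[y] - (scaledS 0).[y]| <= etab / w i).
  by apply: scaled_poly_cvg; apply: divr_gt0.
have evP : eventually0 (fun d => forall j y, l j <= y <= r j ->
    `|(recipS d).[y] - (recipS 0).[y]| <= etab / H).
  by apply: eventually0_forall => j; apply: scaled_poly_cvg; apply: divr_gt0.
have evA : eventually0 (fun d => forall j, d ^+ m.+1 *
    `|sval (poly_itv_bound (w j *: S) (l j) (r j))| <= etab).
  by apply: eventually0_forall => j; apply: eventually0_small_exp.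
have ev1 : eventually0 (fun d => d ^+ m.+1 * 1 <= etab) by apply: eventually0_small_exp.
apply: (eventually0_imp _ (eventually0_and (eventually0_and evS evP) (eventually0_and evA ev1))) =>
  d d_gt0.
move=> [[dS dP] [dA d1]]; have dm_gt0 : 0 < d ^+ m.+1 by rewrite exprn_gt0.
have [||||x [y [xt yin [crit sum_y]]]] := etabP (A d) (B d) (d ^+ m.+1) (base0 + tau i).
- move=> j y; rewrite /A; have [->|ji] := eqVneq j i.
    move=> yin; rewrite !hornerZ -mulrBr normrM gtr0_norm // mulrC -ler_pdivlMr //.
    exact: dS.
  move=> yin; rewrite expr0n mul0r scale0r horner0 subr0 -scalerA hornerZ normrM.
  rewrite (gtr0_norm dm_gt0); apply: le_trans (dA j); rewrite ler_pM2l //.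
  move/(svalP (poly_itv_bound (w j *: S) (l j) (r j))): yin => /le_trans; apply.
  exact: ler_norm.
- move=> j y; rewrite /B; have [->|ji] := eqVneq j i.
    by move=> _; rewrite subrr normr0 ltW.
  move=> yin; rewrite !hornerD !hornerZ opprD addrACA subrr add0r.
  by rewrite -mulrBr normrM gtr0_norm // mulrC -ler_pdivlMr //; apply: (dP j).
- by rewrite subr0 gtr0_norm // -[_ ^+ _]mulr1.
- by rewrite subrr normr0 ltW.
exists x; first by rewrite -[_ / _]opprK.
pose q j := base d j + (tau i + d ^+ m.+1 * x) *: slope j.
have qE j : q j = (tau i - tau j + d ^+ m.+1 * x) * w j *: S + H *: recipS d.
  rewrite /q /base /slope scalerA addrAC -scalerDl; congr (_ *: _ + _); ring.
(* Undoes the substitution: block i is the rescaled one at d z. *)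
have qi : q i = (B d i + x *: A d i) \Po (d *: 'X).
  rewrite qE /A /B eqxx subrr add0r rmorphD /= !comp_polyZ recipS_comp scaledS_comp addrC.
  by rewrite !scalerA; congr (_ + _ *: _); ring.
have qj j : j != i -> q j = B d j + x *: A d j.
  move=> /negPf ji; rewrite qE /A /B ji scalerA [RHS]addrAC -scalerDl.
  by congr (_ *: _ + _); ring.
have dy : (d *: 'X).[y i / d] = y i.
  by rewrite hornerZ hornerX mulrCA divff ?mulr1 // gt_eqF.
exists (fun j => if j == i then y j / d else y j); split=> [j|].
  rewrite -/(q j); have [->|ji] := eqVneq j i; last by rewrite qj.
  by rewrite qi deriv_comp hornerM horner_comp dy (crit i) mul0r.
rewrite -[RHS]sum_y mulr1 [X in base0 + (_ + X)]mulrC addrA; congr (_ + _).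
apply: eq_bigr => j _; rewrite -/(q j).
have [->|ji] := eqVneq j i; last by rewrite qj.
by rewrite qi horner_comp dy.
Qed.

(** The perturbation is at most |th| U on the interval, less than half of the gap [gam], so the
    extremum is not attained at an end. *)
Lemma extremal_exists k (th U gam : R) :
  (c k + eta) ^+ m.+1 <= U ->
  gam <= sg k * (S.[c k - eta] - S.[c k]) ->
  gam <= sg k * (S.[c k + eta] - S.[c k]) ->
  2 * (`|th| * U) < gam ->
  exists u v, extremal k th u v /\ `|v - S.[c k]| <= `|th| * U.
Proof.
move=> cU gl gr thU; set p := S + th *: 'X^(m.+1).
have pE x : p.[x] = S.[x] + th * x ^+ m.+1 by rewrite /p !hornerE.
have cm_gt0 : 0 < c k - eta by rewrite subr_gt0.
have [u uin umin] : exists2 u, c k - eta <= u <= c k + eta &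
    forall x, c k - eta <= x <= c k + eta -> sg k * p.[u] <= sg k * p.[x].
  have [|u uin umin] := @poly_argmin R (sg k *: p) (c k - eta) (c k + eta).
    by have := eta_gt0; lra.
  by exists u => // x xin; rewrite -!hornerZ; apply: umin.
have thx x : c k - eta <= x <= c k + eta -> `|th * x ^+ m.+1| <= `|th| * U.
  move=> /andP[lx xr]; rewrite normrM ler_wpM2l // normrX.
  have x_gt0 : 0 < x by apply: lt_le_trans lx.
  rewrite (gtr0_norm x_gt0) (le_trans _ cU) // lerXn2r // nnegrE ltW //.
  exact: lt_le_trans xr.
have cin : c k - eta <= c k <= c k + eta by have := eta_gt0; lra.
have lin : c k - eta <= c k - eta <= c k + eta by have := eta_gt0; lra.
have rin : c k - eta <= c k + eta <= c k + eta by have := eta_gt0; lra.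
have mc := umin _ cin; rewrite !pE in mc.
have tc := thx _ cin; have tl := thx _ lin; have tr := thx _ rin; have tu := thx _ uin.
have Su := sg_minW uin.
rewrite !ler_norml in tc tl tr tu.
have sl : sg k * p.[u] < sg k * p.[c k - eta].
  rewrite !pE; clear -mc tc tl gl thU sgP.
  by case: (sgP k) gl mc => -> gl mc; rewrite ?mul1r ?mulN1r in gl mc *; lra.
have sr : sg k * p.[u] < sg k * p.[c k + eta].
  rewrite !pE; clear -mc tc tr gr thU sgP.
  by case: (sgP k) gr mc => -> gr mc; rewrite ?mul1r ?mulN1r in gr mc *; lra.
exists u, p.[u]; split; last first.
  rewrite ler_norml pE.
  case: (sgP k) mc Su => -> mc Su; rewrite ?mul1r ?mulN1r in mc Su;
    apply/andP; split; lra.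
split; rewrite -?pE //; last by move=> x xin; rewrite -pE; apply: umin.
case/andP: uin => lu ur; rewrite !lt_neqAle lu ur !andbT; apply/andP; split.
  by apply/eqP => eqlu; rewrite eqlu ltxx in sl.
by apply/eqP => equr; rewrite -equr ltxx in sr.
Qed.

(** On positive x the function increases with th, hence so does its minimum or maximum: each
    extremum is tested at the other's point. *)
Lemma extremal_mono k (th th' u v u' v' : R) :
  extremal k th u v -> extremal k th' u' v' -> th < th' -> v < v'.
Proof.
have pow_gt0 x : c k - eta < x < c k + eta -> 0 < x ^+ m.+1.
  by case/andP=> lx _; rewrite exprn_gt0 // (le_lt_trans _ lx) // subr_ge0 ltW.
have W x : c k - eta < x < c k + eta -> c k - eta <= x <= c k + eta.
  by case/andP=> /ltW -> /ltW ->.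
move=> [uin vE vmin _ _] [uin' vE' vmin' _ _] tht.
have h := vmin _ (W _ uin'); have h' := vmin' _ (W _ uin).
have p : th * u ^+ m.+1 < th' * u ^+ m.+1 by rewrite ltr_pM2r // pow_gt0.
have p' : th * u' ^+ m.+1 < th' * u' ^+ m.+1 by rewrite ltr_pM2r // pow_gt0.
clear -h h' p p' vE vE' sgP.
by case: (sgP k) h h' => -> h h'; rewrite ?mul1r ?mulN1r in h h'; lra.
Qed.

End TwoScales.

(** * Choice of the parameters and count of the solutions *)

Section Assembly.

Variables (R : realType) (n m : nat).
Hypotheses (n_gt1 : (1 < n)%N) (m_gt0 : (0 < m)%N).
Local Notation T := {ffun 'I_n -> 'I_m}.

Lemma tau_dist (i j : 'I_n) : i != j -> 1 <= `|tau R i - tau R j|.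
Proof.
move=> ij; rewrite /tau; have [lt|lt|/val_inj eqij] := ltngtP i j; last first.
- by rewrite eqij eqxx in ij.
- by rewrite ger0_norm ?subr_ge0 ?ler_nat ?(ltnW lt) // -natrB ?(ltnW lt) // ler1n subn_gt0.
- rewrite distrC ger0_norm ?subr_ge0 ?ler_nat ?(ltnW lt) // -natrB ?(ltnW lt) //.
  by rewrite ler1n subn_gt0.
Qed.

Lemma tau_inj (i j : 'I_n) : i != j -> tau R i != tau R j.
Proof.
move=> /tau_dist; apply: contraTneq => ->.
by rewrite subrr normr0 -ltNge ltr01.
Qed.

(** For w_j = x^(j+1) every condition is the nonvanishing at x of a nonzero polynomial, and finitely
    many of these have a common positive non-root. *)
Lemma weights_exist (S : {poly R}) (c : 'I_m -> R) :
  injective (fun k => S.[c k]) ->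
  exists w : 'I_n -> R, [/\ forall j, 0 < w j,
    forall s, far_slope S c w s != 0,
    injective (far_slope S c w)
    & forall i (s s' : T), (exists2 j, j != i & s j != s' j) ->
        near_level S c w i s != near_level S c w i s'].
Proof.
move=> injS; pose lin (a : 'I_n -> R) : {poly R} := \sum_j a j *: 'X^(j.+1).
have lin_coef a (j : 'I_n) : (lin a)`_j.+1 = a j.
  rewrite coef_sum (bigD1 j) //= coefZ coefXn eqxx mulr1 big1 ?addr0 // => k kj.
  rewrite coefZ coefXn eqSS eq_sym (_ : (k : nat) == j = false) ?mulr0 //.
  by apply/negbTE; apply: contra kj => /eqP kj; apply/eqP/val_inj.
have lin0 a : (lin a)`_0 = 0.
  by rewrite coef_sum big1 // => k _; rewrite coefZ coefXn mulr0.
have linE a x : (lin a).[x] = \sum_j a j * x ^+ j.+1.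
  by rewrite horner_sum; apply: eq_bigr => j _; rewrite hornerZ hornerXn.
have lin_neq0 a (j : 'I_n) : a j != 0 -> lin a != 0.
  by move=> aj; apply: contraNneq aj => l0; rewrite -lin_coef l0 coef0.
pose e (s : T) j := S.[c (s j)].
(* [None] carries the two conditions on [far_slope] and [Some i] the one on [near_level]; where
   there is no condition the polynomial is 1. *)
pose F (p : T * T * option 'I_n) : {poly R} := match p with
  | (s, s', None) => if s == s' then 1 + lin (e s) else lin (fun j => e s j - e s' j)
  | (s, s', Some i) => if [exists j, (j != i) && (s j != s' j)]
      then lin (fun j => (tau R i - tau R j) * (e s j - e s' j)) else 1 end.
have e_neq (s s' : T) j : s j != s' j -> e s j - e s' j != 0.
  by apply: contra; rewrite subr_eq0 => /eqP /injS ->.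
have F_neq0 p : F p != 0.
  case: p => [[s s'] [i|]] /=.
    case: ifP => [/existsP[j /andP[ji sj]]|_]; last exact: oner_neq0.
    apply: (@lin_neq0 _ j); rewrite mulf_neq0 ?e_neq //.
    by rewrite subr_eq0 tau_inj // eq_sym.
  have [_|ss'] := eqVneq s s'.
    apply/eqP => /(congr1 (fun p : {poly R} => p`_0)) /eqP.
    by rewrite coefD lin0 coef1 coef0 addr0 oner_eq0.
  have [j sj] : exists j, s j != s' j.
    apply/existsP; rewrite -negb_forall; apply: contra ss' => /forallP eqs.
    by apply/eqP/ffunP => j; apply/eqP.
  by apply: (@lin_neq0 _ j); apply: e_neq.
have [x x_gt0 Fx] := poly_nonroot_family 0 F_neq0.
exists (fun j => x ^+ j.+1); split=> [j|s|s s' eqs|i s s' [j ji sj]].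
- exact: exprn_gt0.
- have := Fx (s, s, None); rewrite /= eqxx hornerD hornerC linE.
  by under eq_bigr do rewrite mulrC.
- apply/eqP; apply: contraT => ss'; have := Fx (s, s', None); rewrite /= (negPf ss') linE.
  suff -> : \sum_j (e s j - e s' j) * x ^+ j.+1 = 0 by rewrite eqxx.
  have -> : \sum_j (e s j - e s' j) * x ^+ j.+1 =
      far_slope S c (fun j => x ^+ j.+1) s - far_slope S c (fun j => x ^+ j.+1) s'.
    rewrite /far_slope opprD addrACA subrr add0r -sumrB.
    by apply: eq_bigr => k _; rewrite -mulrBr mulrC.
  by rewrite eqs subrr.
- have := Fx (s, s', Some i) => /=; case: existsP => [_|[]]; last first.
    by exists j; rewrite ji.
  rewrite linE; apply: contra => /eqP eqN.
  have -> : \sum_k (tau R i - tau R k) * (e s k - e s' k) * x ^+ k.+1 =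
      near_level S c (fun j => x ^+ j.+1) i s - near_level S c (fun j => x ^+ j.+1) i s'.
    rewrite /near_level opprD addrACA subrr add0r -sumrB (bigD1 i) //=.
    by rewrite subrr !mul0r add0r; apply: eq_bigr => k _; rewrite /e; ring.
  by rewrite eqN subrr.
Qed.

(** The conditions are affine in H: as the slopes differ, two roots coincide for a single H, and a
    root equals [tau i] for a single H. *)
Lemma height_exists (S : {poly R}) (c : 'I_m -> R) (w : 'I_n -> R) (B : R) :
  (forall s, far_slope S c w s != 0) -> injective (far_slope S c w) ->
  exists H : R, [/\ B < H, injective (far_root S c w H)
    & forall s (i : 'I_n), far_root S c w H s != tau R i].
Proof.
move=> sN0 injs; pose b := far_slope S c w.
pose A (s : T) := \sum_j tau R j * w j * S.[c (s j)].
pose F (p : T * T + T * 'I_n) : {poly R} := match p with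
  | inl (s, s') => if s == s' then 1 else
      (A s * b s' - A s' * b s)%:P - (b s' - b s) *: 'X
  | inr (s, i) => (A s - tau R i * b s)%:P - 'X end.
have F_neq0 p : F p != 0.
  case: p => [[s s']|[s i]] /=; last first.
    apply/eqP => /(congr1 (fun p : {poly R} => p`_1)) /eqP.
    by rewrite coefB coefC coefX coef0 sub0r oppr_eq0 oner_eq0.
  have [_|ss'] := eqVneq s s'; first exact: oner_neq0.
  apply: contraNneq ss' => /(congr1 (fun p : {poly R} => p`_1)) /eqP.
  rewrite coefB coefC coefZ coefX coef0 sub0r mulr1 oppr_eq0 subr_eq0.
  by move=> /eqP /injs ->.
have [H BH FH] := poly_nonroot_family B F_neq0; exists H; split=> // [s s' eqs|s i].
  apply/eqP; apply: contraT => ss'; have := FH (inl (s, s')).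
  rewrite /= (negPf ss') hornerD hornerC hornerN hornerZ hornerX.
  suff -> : A s * b s' - A s' * b s - (b s' - b s) * H = 0 by rewrite eqxx.
  have rE u : A u - H = far_root S c w H u * b u by rewrite mulfVK.
  transitivity ((A s - H) * b s' - (A s' - H) * b s); first by ring.
  by rewrite !rE eqs; ring.
have := FH (inr (s, i)); rewrite /= hornerD hornerC hornerN hornerX.
apply: contra => /eqP eqs; have rE : A s - H = far_root S c w H s * b s by rewrite mulfVK.
by rewrite addrAC rE eqs subrr.
Qed.

(** S' has degree m and already m positive roots, so 0 is not one. *)
Lemma coef1_neq0 (S : {poly R}) (c : 'I_m -> R) :
  size S = m.+2 -> injective c -> (forall k, 0 < c k) ->
  (forall k, S^`().[c k] = 0) -> S`_1 != 0.
Proof.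
move=> sS cI c_gt0 dS; apply/eqP => S1.
have sdS : size S^`() = m.+1 by rewrite polyorder.size_deriv sS.
have dS0 : S^`() != 0 by rewrite -size_poly_gt0 sdS.
have := @max_poly_roots _ S^`() (0 :: codom c) dS0.
rewrite sdS /= size_codom card_ord ltnn => h; apply: notF; apply: h.
  apply/andP; split; first by rewrite /root horner_coef0 coef_deriv S1 mul0rn.
  by apply/allP => _ /codomP[k ->]; apply/eqP/dS.
rewrite (map_inj_uniq cI) enum_uniq andbT; apply/codomP => -[k ck].
by have := c_gt0 k; rewrite -ck ltxx.
Qed.

Lemma star_pencil_max : exists L : {vspace dhomog n.+1 R[i] m.+1},
  [/\ real_pencil L, generic_pencil L
    & contains_real_singular (n.+1 * m ^ n)%N L].
Proof.
have n_gt0 := ltnW n_gt1.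
have [S [c [S_monic sS c_gt0 [cI injS dS ddS]]]] := morse_poly R m.
have [w [w_gt0 slopeN0 inj_slope level_ne]] := weights_exist injS.
have [s|bmin bmin_gt0 bminP] := @finite_pos_lb R T (fun s => `|far_slope S c w s|).
  by rewrite normr_gt0.
pose W := \sum_j w j.
have W_gt0 : 0 < W.
  by rewrite /W (bigD1 (Ordinal n_gt0)) //= ltr_pwDl // sumr_ge0 // => j _; apply: ltW.
(* Chosen so that kap times the total weight is half of the bound [bmin] on the slopes. *)
pose kap := bmin / 2 / W.
have kap_gt0 : 0 < kap by rewrite !divr_gt0.
have [eta [sg [eta_gt0 eta_c sgP sg_min S_close]]] := morse_nbhd kap_gt0 c_gt0 dS ddS.
have kapP s : kap * \sum_j w j <= `|far_slope S c w s| / 2.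
  by rewrite -/W /kap divfK ?gt_eqF // ler_pM2r ?invr_gt0.
(* The diagonal of G gives the gaps at the ends of the intervals, the rest the distances between
   critical values of S. *)
pose G (p : 'I_m * 'I_m) : R := if p.1 == p.2 then
   Num.min (sg p.1 * (S.[c p.1 - eta] - S.[c p.1]))
           (sg p.1 * (S.[c p.1 + eta] - S.[c p.1]))
  else `|S.[c p.1] - S.[c p.2]|.
have [p|gam gam_gt0 gamP] := @finite_pos_lb R _ G.
  rewrite /G; case: eqVneq => [_|pN]; last first.
    by rewrite normr_gt0 subr_eq0; apply: contra pN => /eqP /injS ->.
  have [h1 h2] := sg_min_end eta_gt0 sg_min p.1.
  by rewrite lt_min !mulrBr !subr_gt0 h1.
have gam_end k : gam <= sg k * (S.[c k - eta] - S.[c k]) /\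
    gam <= sg k * (S.[c k + eta] - S.[c k]).
  by have := gamP (k, k); rewrite /G /= eqxx le_min => /andP.
have gam_val k l : k != l -> gam <= `|S.[c k] - S.[c l]|.
  by move=> kl; have := gamP (k, l); rewrite /G /= (negPf kl).
pose U := 1 + \sum_k (c k + eta) ^+ m.+1.
have ce_ge0 k : 0 <= (c k + eta) ^+ m.+1 by rewrite exprn_ge0 // addr_ge0 // ltW.
have U_gt0 : 0 < U by rewrite ltr_pwDl // sumr_ge0.
have UP k : (c k + eta) ^+ m.+1 <= U.
  by rewrite /U (bigD1 k) //= addrCA lerDl addr_ge0 // sumr_ge0.
pose Y := 1 + \sum_(p : 'I_n * T) `|near_level S c w p.1 p.2|.
have Y_gt0 : 0 < Y by rewrite ltr_pwDl // sumr_ge0.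
have YP i s : `|near_level S c w i s| <= Y.
  by rewrite /Y (bigD1 (i, s)) //= addrCA lerDl addr_ge0 // sumr_ge0.
(* The lower bound on H makes th = near_level / H satisfy 2 |th| U < gam. *)
have [H [HB inj_root rootN]] := height_exists (2 * (Y * U) / gam) slopeN0 inj_slope.
have H_gt0 : 0 < H by apply: lt_trans HB; rewrite divr_gt0 // !mulr_gt0.
pose th i s := near_level S c w i s / H.
have thU i s : 2 * (`|th i s| * U) < gam.
  rewrite /th normrM [`|H^-1|]gtr0_norm ?invr_gt0 //.
  have -> : 2 * (`|near_level S c w i s| / H * U) =
    2 * (`|near_level S c w i s| * U) / H by ring.
  rewrite ltr_pdivrMr //; rewrite ltr_pdivrMr // [H * _]mulrC in HB.
  by apply: le_lt_trans HB; rewrite ler_pM2l // ler_pM2r.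
have /choice[uv uvP] : forall p : 'I_n * T, exists uv : R * R,
    extremal S c eta sg (p.2 p.1) (th p.1 p.2) uv.1 uv.2 /\
    `|uv.2 - S.[c (p.2 p.1)]| <= `|th p.1 p.2| * U.
  move=> [i s]; have [g1 g2] := gam_end (s i).
  have [u [v uvP]] := extremal_exists eta_gt0 eta_c sgP sg_min (UP (s i)) g1 g2 (thU i s).
  by exists (u, v).
pose v i s := (uv (i, s)).2.
have extP i (s : T) : extremal S c eta sg (s i) (th i s) (uv (i, s)).1 (v i s).
  by case: (uvP (i, s)).
have v_close i (s : T) : `|v i s - S.[c (s i)]| <= `|th i s| * U by case: (uvP (i, s)).
(* The value determines s i, being within gam / 2 of S at c (s i); then th, by monotonicity; then
   the other coordinates, by the choice of the weights. *)
have v_inj i : injective (v i).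
  move=> s s' eqv; have eqsi : s i = s' i.
    apply/eqP; apply: contraT => /gam_val.
    have := v_close i s; have := v_close i s'; have := thU i s; have := thU i s'.
    rewrite eqv => t1 t2; rewrite distrC => a1 a2 a3.
    have := ler_distD (v i s') S.[c (s i)] S.[c (s' i)].
    rewrite [`|_ - v i s'|]distrC [`|v i s' - S.[c (s' i)]|]distrC => a4.
    by exfalso; clear -t1 t2 a1 a2 a3 a4; lra.
  have eqth : th i s = th i s'.
    have E := extP i s; have E' := extP i s'; rewrite -eqsi in E'.
    have [lt|lt|//] := ltgtP (th i s) (th i s').
      by have := extremal_mono eta_c sgP E E' lt; rewrite eqv ltxx.
    by have := extremal_mono eta_c sgP E' E lt; rewrite eqv ltxx.
  apply/ffunP => j; have [->//|ji] := eqVneq j i; apply/eqP; apply: contraT => sj.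
  have /eqP[] := level_ne i s s' (ex_intro2 _ _ j ji sj).
  by apply: (mulIf (_ : H^-1 != 0)) => //; rewrite invr_eq0 gt_eqF.
pose X i s := - (H * v i s / w i).
have X_inj i : injective (X i).
  move=> s s' /oppr_inj eqX; apply: (v_inj i).
  have wi0 : w i != 0 by rewrite gt_eqF.
  have H0 : H != 0 by rewrite gt_eqF.
  by apply: (mulfI H0); apply: (mulIf (invr_neq0 wi0)).
(* The distances to be resolved: between far roots, from far roots to the [tau i], and between
   rescaled near solutions at the same [tau i]. *)
pose D (p : (T * T + T * 'I_n) + 'I_n * T * T) : R := match p with
  | inl (inl (s, s')) => if s == s' then 1 else `|far_root S c w H s - far_root S c w H s'|
  | inl (inr (s, i)) => `|far_root S c w H s - tau R i|
  | inr (i, s, s') => if s == s' then 1 else `|X i s - X i s'| end.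
have [p|dmin dmin_gt0 dminP] := @finite_pos_lb R _ D.
  case: p => [[[s s']|[s i]]|[[i s] s']] /=.
  - by case: eqVneq => // ss'; rewrite normr_gt0 subr_eq0 (inj_eq inj_root).
  - by rewrite normr_gt0 subr_eq0.
  - by case: eqVneq => // ss'; rewrite normr_gt0 subr_eq0 (inj_eq (X_inj i)).
(* Balls of radius [eps] do not mix up these limits; the bound 1 / 3 separates different [tau i], at
   distance at least 1. *)
pose eps := Num.min (dmin / 3) (1 / 3).
have eps_gt0 : 0 < eps by rewrite lt_min !divr_gt0.
have [eps_d eps1] : 2 * eps < dmin /\ 2 * eps < 1.
  have h1 : eps <= dmin / 3 by rewrite /eps ge_min lexx.
  have h2 : eps <= 1 / 3 by rewrite /eps ge_min lexx orbT.
  by clear -h1 h2 dmin_gt0; split; lra.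
have ev_far : eventually0 (fun d => forall s,
    exists2 t, `|t - far_root S c w H s| <= eps & solution m S w H d t).
  by apply: eventually0_forall => s; apply: far_solution S_close _ _ _ _.
have ev_near : eventually0 (fun d => forall p : 'I_n * T, exists2 x, `|x - X p.1 p.2| <= eps &
    solution m S w H d (tau R p.1 + d ^+ m.+1 * x)).
  apply: eventually0_forall => -[i s] /=.
  have tau_ne j : j != i -> tau R i != tau R j by rewrite eq_sym => /tau_inj.
  have := near_solution S_monic sS w_gt0 H_gt0 eta_gt0 eta_c sgP sg_min tau_ne
    (extP i s) eps_gt0.
  by apply: eventually0_imp => d _; rewrite /X opprK.
have ev_small_near : eventually0 (fun d => forall p : 'I_n * T,
    d ^+ m.+1 * (`|X p.1 p.2| + eps) <= eps).
  by apply: eventually0_forall => p; apply: eventually0_small_exp.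
have S1 := coef1_neq0 sS cI c_gt0 dS.
have ev_inf : eventually0 (fun d => forall p : 'I_n * 'I_n,
    d ^+ m.+1 * `|H * S`_0 * (w p.2 - w p.1)| <= w p.1 * w p.2 / 2).
  by apply: eventually0_forall => p; apply: eventually0_small_exp; rewrite divr_gt0 // mulr_gt0.
have ev_simple : eventually0 (fun d => d <= 1 /\ d * `|S`_0 * S`_m| <= `|S`_1| / 2).
  by apply: eventually0_small; rewrite divr_gt0 // normr_gt0.
have [d0 d0_gt0] := eventually0_and (eventually0_and ev_far ev_near)
  (eventually0_and ev_small_near (eventually0_and ev_inf ev_simple)).
move/(_ d0); rewrite d0_gt0 lexx => /(_ isT) [[far near] [small [inf [_ simple]]]].
have dm_gt0 : 0 < d0 ^+ m.+1 by rewrite exprn_gt0.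
(* One solution for each far choice ([None], s) and each near choice ([Some i], s): (n + 1) m^n
   indices in all. *)
have /choice[tf tfP] : forall p : option 'I_n * T, exists t : R, solution m S w H d0 t /\
   match p with
   | (None, s) => `|t - far_root S c w H s| <= eps
   | (Some i, s) => exists2 x, `|x - X i s| <= eps & t = tau R i + d0 ^+ m.+1 * x end.
  move=> [[i|] s]; last by have [t t1 t2] := far s; exists t.
  by have [x x1 x2] := near (i, s); exists (tau R i + d0 ^+ m.+1 * x); split=> //; exists x.
have near_tau i (s : T) : `|tf (Some i, s) - tau R i| <= eps.
  have [_ [x xX ->]] := tfP (Some i, s).
  rewrite addrC addKr normrM gtr0_norm // (le_trans _ (small (i, s))) // ler_pM2l //.
  have := ler_normD (x - X i s) (X i s); rewrite subrK /=.
  by clear -xX; lra.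
have tf_inj : injective tf.
  have dist (t a b : R) : `|t - a| <= eps -> `|t - b| <= eps -> `|a - b| <= 2 * eps.
    move=> ta tb; have := ler_distD t a b; rewrite [`|a - t|]distrC.
    by clear -ta tb; lra.
  have absurd (a : R) : dmin <= a -> a <= 2 * eps -> False.
    by clear -eps_d; lra.
  move=> [[i|] s] [[j|] s'] eqt.
  - have := near_tau i s; have := near_tau j s'; rewrite -eqt => h1 h2.
    have ij : i = j.
      apply/eqP; apply: contraT => /tau_dist; have := dist _ _ _ h2 h1.
      by clear -eps1; lra.
    rewrite -{j}ij in eqt h1 *.
    have [_ [x xX tx]] := tfP (Some i, s); have [_ [x' xX' tx']] := tfP (Some i, s').
    have xx' : x = x'.
      apply: (mulfI (lt0r_neq0 dm_gt0)); apply: (addrI (tau R i)).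
      by rewrite -tx eqt tx'.
    rewrite -xx' in xX'; have := dminP (inr (i, s, s')) => /=.
    case: eqVneq => [->//|_] /absurd; case.
    exact: dist xX xX'.
  - have [_ h] := tfP (None, s'); rewrite -eqt in h.
    case: (absurd _ (dminP (inl (inr (s', i))))).
    exact: dist h (near_tau i s).
  - have [_ h] := tfP (None, s); rewrite eqt in h.
    case: (absurd _ (dminP (inl (inr (s, j))))).
    exact: dist h (near_tau j s').
  - have [_ h] := tfP (None, s); have [_ h'] := tfP (None, s'); rewrite -eqt in h'.
    have := dminP (inl (inl (s, s'))) => /=; case: eqVneq => [->//|_] /absurd; case.
    exact: dist h h'.
have S_lead : S`_m.+1 = 1 := lead_S S_monic sS.
have base_lead j : (base m S w H d0 j)`_m.+1 = - (tau R j * w j) + H * (S`_0 * d0 ^+ m.+1).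
  by rewrite /base coefD !coefZ S_lead mulr1 coef_poly ltnSn subnn.
have base_next j : (base m S w H d0 j)`_m =
    - (tau R j * w j) * S`_m + H * (S`_1 * d0 ^+ m).
  by rewrite /base coefD !coefZ coef_poly ltnS leqnSn subSnn.
apply: (@star_pencil R n m m_gt0 n_gt1 (base m S w H d0) (slope S w) (base0 n H) 1
  (fun=> c) (codom tf)) => //.
- move=> j; rewrite (leq_trans (size_polyD _ _)) // geq_max.
  by rewrite !(leq_trans (size_scale_leq _ _)) ?sS // size_poly.
- by move=> j; rewrite (leq_trans (size_scale_leq _ _)) ?sS.
- by move=> j; rewrite coefZ S_lead mulr1 gt_eqF.
- by move=> j k; rewrite /slope derivZ hornerZ dS mulr0.
- by move=> j k; rewrite /slope !derivZ hornerZ mulf_neq0 // gt_eqF.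
- move=> s; have := slopeN0 s; rewrite /far_slope.
  by under [X in _ + X != 0 -> _]eq_bigr do rewrite -hornerZ.
(* Up to sign the difference is (tau i - tau j) w_i w_j plus a term of order d^(m+1), which is at
   most half of w_i w_j. *)
- move=> i j ij; rewrite !base_lead !coefZ S_lead !mulr1 -subr_eq0.
  have -> : (- (tau R i * w i) + H * (S`_0 * d0 ^+ m.+1)) * w j -
     (- (tau R j * w j) + H * (S`_0 * d0 ^+ m.+1)) * w i =
     d0 ^+ m.+1 * (H * S`_0 * (w j - w i)) - (tau R i - tau R j) * (w i * w j) by ring.
  rewrite subr_eq0; apply/eqP => eq0; have := inf (i, j); rewrite /=.
  rewrite -[d0 ^+ m.+1 in X in X -> _](gtr0_norm dm_gt0) -normrM eq0 normrM.
  have ww_gt0 : 0 < w i * w j by rewrite mulr_gt0.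
  rewrite [`|w i * w j|]gtr0_norm // => h; have h' := tau_dist ij.
  have : 1 * (w i * w j) <= `|tau R i - tau R j| * (w i * w j) by rewrite ler_pM2r.
  by clear -h ww_gt0; lra.
(* The terms in tau j cancel and leave a nonzero multiple of d S_0 S_m - S_1, where S_1 dominates
   for small d. *)
- move=> j; rewrite base_lead base_next !coefZ S_lead mulr1 -subr_eq0.
  have -> : (- (tau R j * w j) + H * (S`_0 * d0 ^+ m.+1)) * (w j * S`_m) -
     (- (tau R j * w j) * S`_m + H * (S`_1 * d0 ^+ m)) * w j =
     (w j * H * d0 ^+ m) * (d0 * (S`_0 * S`_m) - S`_1) by rewrite exprS; ring.
  apply: mulf_neq0; first by rewrite gt_eqF // !mulr_gt0 // exprn_gt0.
  rewrite subr_eq0; apply/eqP => eq1.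
  have S1_gt0 : 0 < `|S`_1| by rewrite normr_gt0.
  move: simple; rewrite -[d0 in X in X -> _](gtr0_norm d0_gt0) -normrM eq1.
  by rewrite ler_pdivlMr // mulr_natr mulr2n gerDl leNgt S1_gt0.
- rewrite map_inj_uniq ?enum_uniq //.
- by rewrite size_codom card_prod card_option card_ffun !card_ord.
- by move=> t /codomP[p ->]; have [sol _] := tfP p.
Qed.

End Assembly.

(** Bernoulli's inequality (1 - 1 / (m + 1))^k >= 1 - k / (m + 1) without denominators; truncated
    subtraction makes it trivial for large k. *)
Lemma expnS_mul_le m k : (m.+1 ^ k * (m.+1 - k) <= m ^ k * m.+1)%N.
Proof.
elim: k => [|k IHk]; first by rewrite !expn0 subn0.
have step : (m.+1 * (m.+1 - k.+1) <= m * (m.+1 - k))%N.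
  rewrite subSS; case: (leqP k m) => km; last by rewrite (eqP (ltnW km : m - k == 0)%N) muln0.
  by rewrite subSn // mulSn mulnS leq_add2r leq_subr.
rewrite !expnS -!mulnA; apply: leq_trans (leq_mul (leqnn m) IHk).
by rewrite mulnCA [leqRHS]mulnCA leq_mul2l step orbT.
Qed.

Lemma expnS_le_double m n : (2 * n <= m.+1)%N -> (m.+1 ^ n <= 2 * m ^ n)%N.
Proof.
move=> nm; rewrite -(leq_pmul2r (ltn0Sn m)) -mulnA.
apply: leq_trans (leq_mul (leqnn 2) (expnS_mul_le m n)).
rewrite mulnCA leq_mul2l; apply/orP; right.
have le2 : (2 * n + m.+1 <= 2 * m.+1)%N by rewrite [leqRHS]mul2n -addnn leq_add2r.
by rewrite mulnBr leq_subRL // (leq_trans _ le2) // leq_addr.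
Qed.

Theorem corollary6p9 (R : realType) (n : nat) (hn : (14 <= n)%N) :
  exists d0 : nat, forall d : nat, (d0 <= d)%N ->
    exists L : {vspace dhomog n.+1 R[i] d},
      [/\ real_pencil L, generic_pencil L
        & contains_real_singular (4 * d ^ n)%N L].
Proof.
(* For d = m + 1 >= 2 n one has d^n <= 2 m^n, hence 4 d^n <= 8 m^n <= (n + 1) m^n. *)
exists (2 * n)%N => -[|m]; first by rewrite leqn0 muln_eq0 /= => /eqP n0; rewrite n0 in hn.
move=> nm; have n_gt1 : (1 < n)%N by apply: leq_trans hn.
have m_gt0 : (0 < m)%N.
  by rewrite -ltnS (leq_trans _ nm) // (leq_trans n_gt1) // leq_pmull.
have [L [L_real L_generic [s [uniq_s size_s sP]]]] := star_pencil_max R n_gt1 m_gt0.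
exists L; split=> //; exists s; split=> //; apply: leq_trans size_s.
apply: leq_trans (leq_mul (leqnn 4) (expnS_le_double nm)) _.
by rewrite mulnA leq_mul2r; apply/orP; right; apply/leqW/(leq_trans _ hn).
Qed.
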